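(* Let $\mathcal{S}_\ell$ be the set of stressed words of length $\ell$ and let $\Lambda_g$ be a random numerical semigroup of genus $g$ (under the uniform distribution on the finite set of numerical semigroups of genus $g$). Then, for any integer $k$, \[\lim_{g \to \infty}\mathbb{P}[f(\Lambda_g) - 2m(\Lambda_g) = k] = \begin{cases} \frac{1}{\sqrt{5} \cdot S}\varphi^k & k < 0, \\ 0 & k = 0, \\ \frac{1}{\sqrt{5} \cdot S} \sum_{w \in \mathcal{S}_k} \varphi^{1 - g(w)} & k > 0. \end{cases}\]
   Context: A numerical semigroup $\Lambda$ is an additive submonoid of the nonnegative integers $\mathbb{N}_0$ with finite complement $\mathbb{N}_0 \setminus \Lambda$. Its genus is $g(\Lambda) = |\mathbb{N}_0 \setminus \Lambda|$, its multiplicity is $m(\Lambda) = \min(\Lambda \setminus \{0\})$, its conductor is $c(\Lambda) = \min\{c \in \mathbb{N}_0 : c + \mathbb{N}_0 \subseteq \Lambda\}$, its Frobenius number is $f(\Lambda) = c(\Lambda) - 1$, and its depth is $q(\Lambda) = \lceil c(\Lambda)/m(\Lambda) \rceil$. A (possibly empty) word $w = w_1 w_2\cdots w_\ell$ of positive integers is Kunz if $w_i + w_j \geq w_{i+j}$ and $w_i + w_j + 1 \geq w_{i+j-\ell-1}$ for all indices $i,j$ for which these inequalities are defined (that is, all $i, j \in \{1,\dots,\ell\}$ with $i+j \le \ell$, respectively $i+j \ge \ell+2$). It is $3$-Kunz if additionally $w_i \leq 3$ for all $i$. A word of positive integers is stressed if it is $3$-Kunz and ends in $3$. The genus of a word $w$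 is $g(w) = \sum_i w_i$. Let $\varphi = \frac{1+\sqrt 5}{2}$. Let $t_g$ be the number of numerical semigroups of genus $g$ with depth at most $3$, let $s_g = t_g - t_{g-1} - t_{g-2}$ for $g \geq 3$ (equivalently, $s_g$ is the number of stressed words of genus $g$), and let $S = \frac{\varphi}{\sqrt{5}}\left(1 + \sum_{g \geq 3} s_g \varphi^{-g}\right)$. *)

(* Defs.v *)
From HB Require Import structures.
From mathcomp Require Import all_boot all_order all_algebra finmap.
From mathcomp Require Import all_classical all_reals all_analysis.

Set Implicit Arguments.
Unset Strict Implicit.
Unset Printing Implicit Defensive.

Import Order.TTheory GRing.Theory Num.Theory.
Import numFieldNormedType.Exports.

Local Open Scope classical_set_scope.
Local Open Scope ring_scope.

(* [fset_set] is the junk value [fset0] on infinite sets. *)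
Definition card_set (T : choiceType) (A : set T) : nat := #|` fset_set A|%fset.

(* The least element of a nonempty set of naturals (0 if the set is empty). *)
Definition min_set (A : set nat) : nat :=
  xget 0%N [set m | A m /\ forall n, A n -> (m <= n)%N].

Definition numerical_semigroup (L : set nat) : Prop :=
  [/\ L 0%N, forall a b, L a -> L b -> L (a + b)%N & finite_set (~` L)].

Definition genus (L : set nat) : nat := card_set (~` L).

Definition multiplicity (L : set nat) : nat := min_set (L `\` [set 0%N]).

Definition conductor (L : set nat) : nat :=
  min_set [set c | forall n, L (c + n)%N].

(* Integer-valued, since it equals -1 on the semigroup of all naturals. *)
Definition frobenius (L : set nat) : int := (conductor L)%:Z - 1.

Definition depth (L : set nat) : int :=
  Num.ceil ((conductor L)%:R / (multiplicity L)%:R : rat).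

Definition semigroups (g : nat) : set (set nat) :=
  [set L | numerical_semigroup L /\ genus L = g].

(* The probability of the event E under the uniform distribution on the
   finite nonempty set A. *)
Definition uniform_prob_on (R : realType) (T : choiceType) (A E : set T) : R :=
  (card_set (A `&` E))%:R / (card_set A)%:R.

(* The i-th letter of w, letters being numbered from 1. *)
Definition letter (w : seq nat) (i : nat) : nat := nth 0%N w i.-1.

Definition kunz (w : seq nat) : Prop :=
  [/\ forall i, (1 <= i <= size w)%N -> (0 < letter w i)%N,
      forall i j, (1 <= i <= size w)%N -> (1 <= j <= size w)%N ->
        (i + j <= size w)%N ->
        (letter w (i + j) <= letter w i + letter w j)%N
    & forall i j, (1 <= i <= size w)%N -> (1 <= j <= size w)%N ->
        (size w + 2 <= i + j)%N ->
        (letter w (i + j - size w - 1) <= letter w i + letter w j + 1)%N].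

Definition kunz3 (w : seq nat) : Prop :=
  kunz w /\ forall i, (1 <= i <= size w)%N -> (letter w i <= 3)%N.

Definition stressed (w : seq nat) : Prop := kunz3 w /\ last 0%N w = 3%N.

Definition word_genus (w : seq nat) : nat := (\sum_(x <- w) x)%N.

Definition stressed_words (l : nat) : set (seq nat) :=
  [set w | stressed w /\ size w = l].

Definition golden (R : realType) : R := (1 + Num.sqrt 5) / 2.

Definition t_ (g : nat) : nat :=
  card_set [set L | semigroups g L /\ depth L <= 3].

Definition s_ (g : nat) : int :=
  (t_ g)%:Z - (t_ (g - 1))%:Z - (t_ (g - 2))%:Z.

(* The constant S; the series is the limit of its real partial sums, which is a
   junk value unless they converge. *)
Definition growth_constant (R : realType) : R :=
  golden R / Num.sqrt 5 *
    (1 + \big[+%R/0]_(3 <= g <oo) ((s_ g)%:~R * golden R ^- g)).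

(* Main.v *)
Require Import Defs.
From mathcomp Require Import all_boot all_order all_algebra finmap.
From mathcomp Require Import all_classical all_reals all_analysis.
From mathcomp Require Import zify ring lra.

Set Implicit Arguments.
Unset Strict Implicit.
Unset Printing Implicit Defensive.

Import Order.TTheory GRing.Theory Num.Theory.
Import numFieldNormedType.Exports.

(** Write [x] for the inverse of the golden ratio, so that [x + x ^ 2 = 1].

    The least element congruent to [i] modulo the multiplicity [m] of a
    numerical semigroup is [w_i m + i] for some [w_i], and [w_1 ... w_(m-1)] is
    a Kunz word.  This bijection ([semigroup_of], [word_of]) turns the genus
    into the sum of the letters and depth at most 3 into letters at most 3, so
    the theorem speaks of uniformly random Kunz words of genus [g], and a word
    of genus [g] is given the weight [x ^ g].

    For a word with letters at most 3, [f - 2 m] is read off from its end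
    ([offset_stressed], [offset_flat]).  If the last 3 stands at position
    [k > 0], then [f - 2 m = k], and the word is a stressed word of length [k]
    followed by an arbitrary word in the letters 1 and 2.  If there is no 3 and
    the word ends in a 2 followed by [j] ones, then [f - 2 m = - (j + 1)].  Words
    in the letters 1 and 2 are counted by Fibonacci numbers; this gives the
    numerators of the probabilities.  For the denominators, a letter 1 or 2 can
    always be appended to or removed from the end of a 3-Kunz word, so the
    number [t_g] of 3-Kunz words satisfies [t_g = t_(g-1) + t_(g-2) + s_g], and
    [t_g x ^ g] converges to [S] as soon as the sum of the [s_g x ^ g] converges
    ([fibonacci_growth]).

    It remains to see that this sum converges and that the words with a letter
    at least 4 have negligible weight.  Both follow from [bad_words_bound]: the
    total weight of the words of length [n] that have a letter at least 4, or
    have no such letter and end in 3, is exponentially small in [n].  A letter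
    [w_p = q] forces [w_i + w_(p-i) >= q - 1] for all [i], with indices modulo
    [m]: the reflection [i -> p - i] couples the positions in pairs, and the
    total weight of the admissible values of a pair is what a product bound
    ([pair_sum]) needs to be less than 1.  It is if some letter is at least 6.
    When the largest letter is 3, 4 or 5, one reflection falls short, and one
    reflection for each of the last [d] large letters is used,
    [d] being a large constant.  The positions of the letter 1 are then almost
    an independent set of a [d]-regular graph.  Such a set is caught by
    containers ([fingerprint], [container_sum]): a small subset [T] of it
    determines its neighbourhood [F], which is free of ones, and a set of
    positions, not much larger than [F], outside of which there are no ones
    either; the smaller weight on [F] pays for the positions that are left
    unconstrained.  If the [d] last large letters reach far to the left, most
    letters are small, and a single reflection is enough after all. *)

(** * Cardinals of finite sets *)

Section CardSet.
Local Open Scope classical_set_scope.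

Lemma card_set_seq (T : choiceType) (A : set T) (s : seq T) :
  uniq s -> (forall x, A x <-> x \in s) -> card_set A = size s.
Proof.
move=> us As; have -> : A = [set` seq_fset tt s].
  by apply/funext => x; apply/propext; split => [/As|] h; [|apply/As]; move: h; rewrite -(seq_fsetE tt).
by rewrite /card_set set_fsetK size_seq_fset undup_id.
Qed.

Lemma finite_set_enum (T : choiceType) (A : set T) : finite_set A ->
  exists s, [/\ uniq s, forall x, A x <-> x \in s & card_set A = size s].
Proof.
move=> /finite_seqP[s ->]; exists (undup s).
have h x : [set` s] x <-> x \in undup s by rewrite mem_undup.
by split; rewrite ?undup_uniq //; apply: card_set_seq => //; apply: undup_uniq.
Qed.

Lemma card_set_image (T U : choiceType) (f : T -> U) (A : set T) : finite_set A ->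
  {in A &, injective f} -> card_set (f @` A) = card_set A.
Proof.
move=> /finite_set_enum[s [us As ->]] finj.
have us' : uniq [seq f x | x <- s].
  by rewrite map_inj_in_uniq // => x y xs ys; apply: finj; rewrite inE; apply/As.
rewrite (card_set_seq us') ?size_map // => y; split.
  by case=> x /As xs <-; apply: map_f.
by case/mapP => x /As Ax ->; exists x.
Qed.

Lemma card_set_le (T : choiceType) (A B : set T) : finite_set B -> A `<=` B ->
  (card_set A <= card_set B)%N.
Proof.
move=> fB AB; have /finite_set_enum[s [us As ->]] := sub_finite_set AB fB.
have /finite_set_enum[t [ut Bt ->]] := fB.
by apply: uniq_leq_size => // x /As /AB /Bt.
Qed.

Lemma card_setU (T : choiceType) (A B : set T) : finite_set A -> finite_set B ->
  (forall x, A x -> B x -> False) -> card_set (A `|` B) = (card_set A + card_set B)%N.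
Proof.
move=> /finite_set_enum[s [us As ->]] /finite_set_enum[t [ut Bt ->]] AB.
rewrite -size_cat; apply: card_set_seq => [|x].
  rewrite cat_uniq us ut andbT /=; apply/hasPn => x xt; apply/negP => xs.
  by apply: (AB x); [apply/As | apply/Bt].
rewrite mem_cat; split.
  by case=> [/As ->|/Bt ->]; rewrite ?orbT.
by case/orP => [/As|/Bt]; [left | right].
Qed.

End CardSet.

(** * Numerical semigroups and Kunz words *)

Lemma carry q m r : (m <= r -> q * m + r = q.+1 * m + (r - m))%N.
Proof. rewrite mulSn; lia. Qed.

Section Semigroups.
Local Open Scope classical_set_scope.
Implicit Types (L : set nat) (w u v : seq nat).

Lemma min_setP (A : set nat) : A !=set0 ->
  A (min_set A) /\ forall n, A n -> (min_set A <= n)%N.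
Proof.
case=> n0 An0; rewrite /min_set.
have [m [Am mmin]] : exists m, A m /\ forall n, A n -> (m <= n)%N.
  have ex : exists n, `[< A n >] by exists n0; apply/asboolP.
  case: (ex_minnP ex) => m /asboolP Am mmin; exists m; split => // n An.
  by apply: mmin; apply/asboolP.
by have := @xgetPex nat 0%N [set m | A m /\ forall n, A n -> (m <= n)%N] (ex_intro _ m (conj Am mmin)).
Qed.

Lemma min_set_eq (A : set nat) m : A m -> (forall n, A n -> (m <= n)%N) -> min_set A = m.
Proof.
move=> Am mmin; have [h1 h2] := min_setP (ex_intro _ m Am).
by apply/eqP; rewrite eqn_leq h2 //= mmin.
Qed.

Lemma cofinite_bound L : finite_set (~` L) -> exists N, forall n, (N <= n)%N -> L n.
Proof.
move=> /finite_seqP[s Ls]; exists (\max_(x <- s) x).+1 => n sn.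
apply: contrapT => Ln; have : (~` L) n by [].
rewrite Ls /= => ns; move: sn; rewrite ltnNge => /negP; apply.
exact: leq_bigmax_seq.
Qed.

(** The leading 0 is the Kunz coordinate of the residue class 0: with it, the
    Kunz inequalities hold for the residue 0 as well. *)
Definition coord w i := nth 0%N (0%N :: w) i.

Definition semigroup_of w : set nat :=
  [set n | (coord w (n %% (size w).+1) <= n %/ (size w).+1)%N].

Lemma letterE w i : (0 < i)%N -> letter w i = coord w i.
Proof. by case: i. Qed.

Lemma coord_over w i : (size w < i)%N -> coord w i = 0%N.
Proof. by case: i => // i si; rewrite /coord /= nth_default. Qed.

Lemma semigroup_ofE w a i : (i < (size w).+1)%N ->
  semigroup_of w (a * (size w).+1 + i)%N <-> (coord w i <= a)%N.
Proof. by move=> im; rewrite /semigroup_of /= modnMDl divnMDl // modn_small // divn_small ?addn0. Qed.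

Lemma semigroup_of_lt w i : (i < (size w).+1)%N -> semigroup_of w i <-> coord w i = 0%N.
Proof.
move=> im; have := semigroup_ofE 0 im; rewrite mul0n add0n leqn0.
by move=> ->; split => [/eqP|->].
Qed.

Lemma kunz_pos w i : kunz w -> (0 < i <= size w)%N -> (0 < coord w i)%N.
Proof. by move=> [h _ _] /andP[i0 ?]; rewrite -letterE // h ?i0. Qed.

Lemma kunz_add w i j : kunz w -> (i + j <= size w)%N ->
  (coord w (i + j) <= coord w i + coord w j)%N.
Proof.
case=> _ h _; case: i => [|i]; first by rewrite !add0n.
case: j => [|j]; first by rewrite !addn0.
move=> ij; have /= := h i.+1 j.+1; rewrite !letterE ?addSn //; apply => //.
  by apply: leq_trans ij; rewrite leq_addr.
by apply: leq_trans ij; rewrite leq_addl.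
Qed.

Lemma kunz_wrap w i j : kunz w -> (i <= size w)%N -> (j <= size w)%N -> (size w < i + j)%N ->
  (coord w (i + j - (size w).+1) <= coord w i + coord w j + 1)%N.
Proof.
case=> _ _ h im jm; rewrite leq_eqVlt => /orP[/eqP <-|ij]; first by rewrite subnn.
have i0 : (0 < i)%N by rewrite lt0n; apply/eqP => i0; move: ij jm; rewrite i0; lia.
have j0 : (0 < j)%N by rewrite lt0n; apply/eqP => j0; move: ij im; rewrite j0; lia.
have := h i j; rewrite i0 j0 im jm !letterE //; last by lia.
have -> : (i + j - size w - 1 = i + j - (size w).+1)%N by lia.
by apply => //; lia.
Qed.

(** Crude, but enough for cofiniteness: past [max w * m] every quotient by [m] is at
    least every Kunz coordinate. *)
Lemma semigroup_of_cofinite w n : ((\max_(x <- w) x) * (size w).+1 <= n)%N -> semigroup_of w n.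
Proof.
move=> h; rewrite /semigroup_of /=.
apply: (@leq_trans (\max_(x <- w) x)); last by rewrite leq_divRL.
rewrite /coord; have := mem_nth 0%N (s := 0%N :: w).
have im : (n %% (size w).+1 < size (0%N :: w))%N by rewrite ltn_mod.
move=> /(_ _ im); rewrite inE => /orP[/eqP ->//|iw].
exact: leq_bigmax_seq.
Qed.

Lemma semigroup_of_kunz w : kunz w -> numerical_semigroup (semigroup_of w).
Proof.
move=> kw; split.
- by rewrite /semigroup_of /= mod0n.
- move=> a b; set m := (size w).+1.
  rewrite {1}(divn_eq a m) {1}(divn_eq b m).
  have am : (a %% m < m)%N by rewrite ltn_mod.
  have bm : (b %% m < m)%N by rewrite ltn_mod.
  move=> /(semigroup_ofE _ am) ha /(semigroup_ofE _ bm) hb.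
  rewrite {1}(divn_eq a m) {1}(divn_eq b m) addnACA -mulnDl.
  have [s1|s1] := ltnP (a %% m + b %% m) m.
    apply/(semigroup_ofE _ s1); apply: leq_trans (leq_add ha hb).
    exact: kunz_add.
  rewrite carry //.
  have s2 : (a %% m + b %% m - m < m)%N by rewrite ltn_subLR // -addnS leq_add // ltnW.
  apply/(semigroup_ofE _ s2); rewrite -addn1.
  apply: leq_trans (leq_add (leq_add ha hb) (leqnn 1)).
  by apply: kunz_wrap => //; rewrite -ltnS.
apply: (@sub_finite_set _ _ `I_((\max_(x <- w) x) * (size w).+1)); last exact: finite_II.
move=> n /= Ln; rewrite ltnNge; apply/negP => h; apply: Ln; exact: semigroup_of_cofinite.
Qed.

(** The gaps congruent to [i] are [a m + i] with [a < w_i]. *)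
Lemma semigroup_of_genus w : genus (semigroup_of w) = word_genus w.
Proof.
rewrite /genus; set m := (size w).+1.
pose s := [seq (a * m + i)%N | i <- iota 0 m, a <- iota 0 (coord w i)].
have us : uniq s.
  apply: allpairs_uniq_dep => [|i _|]; [exact: iota_uniq | exact: iota_uniq |].
  move=> [i a] [j b] /allpairsPdep[i' [a' [i'm _ [-> ->]]]] /allpairsPdep[j' [b' [j'm _ [-> ->]]]] /= e.
  move: i'm j'm; rewrite !mem_iota /= !add0n => i'm j'm.
  have := congr1 (fun n => n %% m)%N e; rewrite !modnMDl !modn_small // => ij.
  move: e; rewrite ij => /addIn/eqP; rewrite eqn_pmul2r // => /eqP ->.
  by [].
rewrite (card_set_seq us) => [|n].
  rewrite /s size_allpairs_dep -[RHS]sumnE.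
  have -> : [seq size (iota 0 (coord w i)) | i <- iota 0 m] = 0%N :: w.
    apply: (@eq_from_nth _ 0%N) => [|i]; first by rewrite size_map size_iota.
    rewrite size_map size_iota => im.
    by rewrite (nth_map 0%N) ?size_iota // nth_iota // size_iota.
  by rewrite /word_genus /= add0n.
rewrite /=; split => [/negP|/allpairsPdep[i [a [im ai ->]]]].
  rewrite -ltnNge => h; apply/allpairsPdep; exists (n %% m)%N, (n %/ m)%N.
  by rewrite !mem_iota /= !add0n ltn_mod h -divn_eq.
move: im ai; rewrite !mem_iota /= !add0n => im ai /(semigroup_ofE _ im).
by rewrite leqNgt ai.
Qed.

Lemma semigroup_of_multiplicity w : kunz w -> multiplicity (semigroup_of w) = (size w).+1.
Proof.
move=> kw; apply: min_set_eq => [|n [/= hn n0]].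
  split => //; rewrite /semigroup_of /= divnn modnn //.
have [nm|//] := ltnP n (size w).+1.
move: hn => /(semigroup_of_lt nm) c0; have := @kunz_pos w n kw.
by rewrite c0 lt0n -ltnS nm andbT => h; move: n0; case: (n) h => // k /(_ isT).
Qed.

(** Bounding the conductor is a matter of membership; this avoids computing it
    as a maximum of the [(w_i - 1) m + i]. *)
Lemma conductor_leP L c : finite_set (~` L) ->
  (conductor L <= c)%N <-> forall n, (c <= n)%N -> L n.
Proof.
move=> /cofinite_bound[N LN].
have [|h1 h2] := @min_setP [set c | forall n, L (c + n)%N].
  by exists N => n /=; apply: LN; apply: leq_addr.
split => [ec n cn|h]; last by apply: h2 => n; apply: h; apply: leq_addr.
by rewrite -(subnKC (leq_trans ec cn)); apply: h1.
Qed.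

Lemma frobenius_eq L F : finite_set (~` L) -> ~ L F -> (forall n, (F < n)%N -> L n) ->
  frobenius L = (F%:Z)%R.
Proof.
move=> fL LF FL; suff : conductor L = F.+1 by rewrite /frobenius => ->; rewrite -addn1 PoszD addrK.
apply/eqP; rewrite eqn_leq; apply/andP; split; first by apply/conductor_leP.
rewrite ltnNge; apply/negP => /conductor_leP h; apply: LF; exact: h.
Qed.

Lemma semigroup_of_depth w : kunz w -> (depth (semigroup_of w) <= 3)%R <->
  forall i, (coord w i <= 3)%N.
Proof.
move=> kw; rewrite /depth semigroup_of_multiplicity //.
have m0 : ((0 : rat) < (size w).+1%:R)%R by rewrite ltr0n.
have -> : (Num.ceil ((conductor (semigroup_of w))%:R / (size w).+1%:R : rat) <= 3)%R
    = (conductor (semigroup_of w) <= 3 * (size w).+1)%N.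
  by rewrite ceil_le_int ler_pdivrMr // -[X in (_ <= X * _)%R]/(3%:R)%R -natrM ler_nat.
have [_ _ fin] := semigroup_of_kunz kw.
split => [/(conductor_leP _ fin) h i|h].
  have [im|im] := ltnP i (size w).+1; last by rewrite coord_over.
  by apply/(semigroup_ofE 3 im); apply: h; apply: leq_addr.
apply/(conductor_leP _ fin) => n hn; rewrite /semigroup_of /=.
by apply: leq_trans (h _) _; rewrite leq_divRL.
Qed.

Section FromSemigroup.
Variable L : set nat.
Hypothesis sL : numerical_semigroup L.
Let m := multiplicity L.

Lemma mult_spec : [/\ (0 < m)%N, L m & forall n, (0 < n < m)%N -> ~ L n].
Proof.
case: sL => L0 LD /cofinite_bound[N LN].
have [|[Lm /= m0] mmin] := @min_setP (L `\` [set 0%N]).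
  by exists N.+1; split => //; apply: LN.
split => [|//|n /andP[n0 nm] Ln]; first by rewrite lt0n; apply/eqP.
suff : (m <= n)%N by rewrite leqNgt nm.
by apply: mmin; split => //= n0'; rewrite n0' in n0.
Qed.

Definition kunz_coord i := min_set [set a | L (a * m + i)%N].

(** Each residue class meets [L] in an up-set, since [m] belongs to [L]. *)
Lemma kunz_coordP a i : L (a * m + i)%N <-> (kunz_coord i <= a)%N.
Proof.
have [m0 Lm _] := mult_spec; case: sL => L0 LD /cofinite_bound[N LN].
have [|h1 h2] := @min_setP [set a | L (a * m + i)%N].
  by exists N => /=; apply: LN; apply: leq_trans (leq_addr _ _); apply: leq_pmulr.
have Lmul k : L (k * m)%N by elim: k => // k IH; rewrite mulSn; apply: LD.
split => [/h2//|ea].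
rewrite -(subnK ea) mulnDl -addnA; apply: LD => //; exact: h1.
Qed.

Definition word_of := [seq kunz_coord i | i <- iota 1 m.-1].

Lemma size_word_of : size word_of = m.-1.
Proof. by rewrite size_map size_iota. Qed.

Lemma coord_word_of i : (i < m)%N -> coord word_of i = kunz_coord i.
Proof.
have [m0 Lm _] := mult_spec; case: sL => L0 _ _.
case: i => [_|i im].
  by symmetry; apply/eqP; rewrite -leqn0; apply/kunz_coordP; rewrite mul0n.
rewrite /coord /= (nth_map 0%N) ?size_iota; last by lia.
by rewrite nth_iota; last lia.
Qed.

Lemma semigroup_of_word_of : semigroup_of word_of = L.
Proof.
have [m0 Lm _] := mult_spec.
apply/funext => n; apply/propext; rewrite /semigroup_of /= size_word_of prednK //.
by rewrite coord_word_of ?ltn_mod // {3}(divn_eq n m); split => /kunz_coordP.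
Qed.

(** Both families of Kunz inequalities say that the sum of the least elements
    of two residue classes belongs to [L]; the extra 1 is the carry when the
    residues add up to more than [m]. *)
Lemma kunz_word_of : kunz word_of.
Proof.
have [m0 Lm Lmin] := mult_spec; case: (sL) => L0 LD _.
have sm i : (i <= size word_of)%N -> (i < m)%N by rewrite size_word_of; lia.
have sum i j : L ((kunz_coord i + kunz_coord j) * m + (i + j))%N.
  by rewrite mulnDl addnACA; apply: LD; apply/kunz_coordP.
split=> [i /andP[i0 /sm im]|i j /andP[i0 /sm im] /andP[j0 /sm jm] /sm ij|
   i j /andP[i0 im] /andP[j0 jm] ij].
- rewrite letterE // coord_word_of // lt0n; apply/eqP => c0.
  by apply: (Lmin i); rewrite ?i0 //; have /kunz_coordP : (kunz_coord i <= 0)%N by rewrite c0.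
- by rewrite !letterE ?addn_gt0 ?i0 // !coord_word_of //; apply/kunz_coordP; apply: sum.
have mS : (size word_of).+1 = m by rewrite size_word_of prednK.
have kpos : (0 < i + j - size word_of - 1)%N by lia.
rewrite !letterE // !coord_word_of ?sm //; last by lia.
apply/kunz_coordP; have := sum i j; congr (L _).
rewrite addn1 mulSn; lia.
Qed.

End FromSemigroup.

(** The length is recovered from the multiplicity, the letters from membership. *)
Lemma semigroup_of_inj : {in [set w | kunz w] &, injective semigroup_of}.
Proof.
move=> w1 w2; rewrite !inE /= => k1 k2 e.
have es : size w1 = size w2.
  by have := semigroup_of_multiplicity k1; rewrite e semigroup_of_multiplicity // => -[].
apply: (@eq_from_nth _ 0%N) => // i i1.
have i2 : (i < size w2)%N by rewrite -es.
have h a : (coord w1 i.+1 <= a)%N <-> (coord w2 i.+1 <= a)%N.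
  by rewrite -!semigroup_ofE // e es.
by apply/eqP; rewrite eqn_leq; apply/andP; split; [apply/h | apply/(h (coord w1 i.+1))].
Qed.

End Semigroups.

(** * Counting Kunz words by genus *)

Section WordSets.
Local Open Scope classical_set_scope.
Implicit Types (u v w : seq nat) (g : nat).

Definition letters_in lo hi w := all (fun a => lo <= a <= hi) w.

Lemma letters_inP lo hi w :
  reflect (forall i, 0 < i <= size w -> lo <= coord w i <= hi) (letters_in lo hi w).
Proof.
apply: (iffP (all_nthP 0)) => [h [//|i] /andP[_ iw]|h i iw]; first exact: h.
by apply: (h i.+1).
Qed.

Lemma word_genus_cat u v : word_genus (u ++ v) = word_genus u + word_genus v.
Proof. exact: big_cat. Qed.

Lemma word_genus1 a : word_genus [:: a] = a.
Proof. exact: big_seq1. Qed.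

Lemma word_genus_rcons u a : word_genus (rcons u a) = word_genus u + a.
Proof. by rewrite -cats1 word_genus_cat word_genus1. Qed.

Lemma word_genus_cons u a : word_genus (a :: u) = a + word_genus u.
Proof. exact: big_cons. Qed.

Lemma word_genus_nseq j a : word_genus (nseq j a) = j * a.
Proof. by rewrite /word_genus big_nseq iter_addn_0 mulnC. Qed.

Lemma size_le_genus hi w : letters_in 1 hi w -> size w <= word_genus w.
Proof.
elim: w => // a w IH /= /andP[/andP[a1 _] /IH h].
by rewrite word_genus_cons -add1n leq_add.
Qed.

Lemma letter_le_genus w i : coord w i <= word_genus w.
Proof.
case: i => [|i]; first by rewrite /coord.
rewrite /coord /=; elim: w i => [|a w IH] [|i] //=; rewrite word_genus_cons.
  exact: leq_addr.
by apply: leq_trans (IH i) _; apply: leq_addl.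
Qed.

Lemma kunz_letters w : kunz w -> letters_in 1 (word_genus w) w.
Proof.
move=> kw; apply/letters_inP => i iw; rewrite letter_le_genus andbT.
exact: kunz_pos kw iw.
Qed.

(** [short_words n n] contains all Kunz words of genus [n]; the finiteness of the
    sets of words below is deduced from this. *)
Fixpoint short_words n l : seq (seq nat) :=
  if l is l'.+1 then [::] :: [seq a :: w | a <- iota 0 n.+1, w <- short_words n l']
  else [:: [::]].

Lemma mem_short_words n l w : size w <= l -> letters_in 0 n w -> w \in short_words n l.
Proof.
elim: l w => [|l IH] [|a w] // sw /= /andP[an wn].
change (a :: w \in [::] :: [seq b :: v | b <- iota 0 n.+1, v <- short_words n l]).
rewrite in_cons; apply/orP; right; apply/allpairsPdep; exists a, w.
by split => //; [rewrite mem_iota add0n ltnS | apply: IH].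
Qed.

Lemma finite_genus g : finite_set [set w | letters_in 1 (word_genus w) w /\ word_genus w = g].
Proof.
apply: (@sub_finite_set _ _ [set` short_words g g]); last exact: finite_seq.
move=> w /= [lw wg]; apply: mem_short_words; rewrite -wg; first exact: size_le_genus lw.
by apply: sub_all lw => a /andP[_ ->].
Qed.

Definition kunz_words g := [set w | kunz w /\ word_genus w = g].
Definition kunz3_words g := [set w | kunz3 w /\ word_genus w = g].
(** The words of the semigroups of depth at least 4. *)
Definition tall_words g := [set w | [/\ kunz w, word_genus w = g & ~ kunz3 w]].
Definition stressed_genus g := [set w | stressed w /\ word_genus w = g].
(** The words of the semigroups of depth at most 2. *)
Definition flat_words g := [set w | letters_in 1 2 w /\ word_genus w = g].

Lemma finite_kunz_words g : finite_set (kunz_words g).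
Proof.
by apply: sub_finite_set (finite_genus g) => w [/kunz_letters kw wg].
Qed.

Lemma finite_kunz3_words g : finite_set (kunz3_words g).
Proof. by apply: sub_finite_set (finite_kunz_words g) => w [[kw _] wg]. Qed.

Lemma finite_tall_words g : finite_set (tall_words g).
Proof. by apply: sub_finite_set (finite_kunz_words g) => w [kw wg _]. Qed.

Lemma finite_stressed_genus g : finite_set (stressed_genus g).
Proof. by apply: sub_finite_set (finite_kunz3_words g) => w [[kw _] wg]. Qed.

Lemma finite_flat_words g : finite_set (flat_words g).
Proof.
apply: sub_finite_set (finite_genus g) => w [lw wg]; split => //.
apply/letters_inP => i iw; rewrite letter_le_genus andbT.
by case/andP: (letters_inP _ _ _ lw i iw).
Qed.

(** For letters at most 3 the second family of Kunz inequalities is automatic,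
    because [1 + 1 + 1 >= 3]. *)
Lemma kunz3P w : kunz3 w <->
  letters_in 1 3 w /\ forall i j, i + j <= size w -> coord w (i + j) <= coord w i + coord w j.
Proof.
split=> [[kw w3]|[/letters_inP lw wD]].
  split=> [|i j ij]; last exact: kunz_add.
  apply/letters_inP => i iw; rewrite kunz_pos //=; have := w3 i iw.
  by rewrite letterE //; case/andP: iw.
split; last by move=> i iw; rewrite letterE; [case/andP: (lw i iw) | case/andP: iw].
split=> [i iw|i j iw jw ij|i j iw jw ij].
- by rewrite letterE; [case/andP: (lw i iw) | case/andP: iw].
- move: iw jw => /andP[i0 _] /andP[j0 _].
  by rewrite !letterE ?addn_gt0 ?i0 // wD.
have /andP[a1 _] := lw i iw; have /andP[b1 _] := lw j jw.
have kw : 0 < i + j - size w - 1 <= size w by lia.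
have /andP[_ c3] := lw _ kw.
move: iw jw kw => /andP[i0 _] /andP[j0 _] /andP[k0 _].
rewrite !letterE //; apply: leq_trans c3 _; lia.
Qed.

Lemma coord_cat_l u v i : i <= size u -> coord (u ++ v) i = coord u i.
Proof. by move=> iu; rewrite /coord -cat_cons nth_cat /= ltnS iu. Qed.

Lemma coord_cat_r u v i : size u < i -> coord (u ++ v) i = nth 0 v (i - (size u).+1).
Proof. by move=> iu; rewrite /coord -cat_cons nth_cat /= ltnS leqNgt iu. Qed.

Lemma letters_in_nth lo hi v i : letters_in lo hi v -> i < size v -> lo <= nth 0 v i <= hi.
Proof. by move=> /(all_nthP 0) h iv; apply: h. Qed.

(** A new letter 1 or 2 never violates [w_i + w_j >= w_(i+j)], since the left
    side is at least 2, and it enters no inequality for an earlier position. *)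
Lemma kunz3_cat u v : letters_in 1 2 v -> kunz3 (u ++ v) <-> kunz3 u.
Proof.
move=> lv; rewrite !kunz3P /letters_in all_cat; split=> [[/andP[lu _] uvD]|[lu uD]].
  split=> // i j ij; have := uvD i j; rewrite size_cat => /(_ (leq_trans ij (leq_addr _ _))).
  rewrite !coord_cat_l //.
    by apply: leq_trans ij; rewrite leq_addl.
  by apply: leq_trans ij; rewrite leq_addr.
have luv : letters_in 1 3 (u ++ v).
  rewrite /letters_in all_cat lu /=; apply: sub_all lv => a /andP[-> a2].
  exact: leq_trans a2 _.
split=> [|i j ij]; first by move: luv; rewrite /letters_in all_cat.
have [iju|iju] := leqP (i + j) (size u).
  by rewrite !coord_cat_l ?uD //; [apply: leq_trans iju; rewrite leq_addl | apply: leq_trans iju; rewrite leq_addr].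
case: i ij iju => [|i] ij iju; first by rewrite add0n leq_addl.
case: j ij iju => [|j] ij iju; first by rewrite addn0 leq_addr.
have /andP[a1 _] : 1 <= coord (u ++ v) i.+1 <= 3.
  by apply: (letters_inP _ _ _ luv); lia.
have /andP[b1 _] : 1 <= coord (u ++ v) j.+1 <= 3.
  by apply: (letters_inP _ _ _ luv); lia.
have : coord (u ++ v) (i.+1 + j.+1) <= 2.
  rewrite coord_cat_r //; have : i.+1 + j.+1 - (size u).+1 < size v.
    by move: ij; rewrite size_cat; lia.
  by case/(letters_in_nth lv)/andP.
by move=> h; apply: leq_trans h _; rewrite -[2]/(1 + 1) leq_add.
Qed.

Lemma kunz3_nil : kunz3 [::].
Proof. by rewrite kunz3P; split => // -[|i] [|j]. Qed.

Lemma kunz3_flat v : letters_in 1 2 v -> kunz3 v.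
Proof. by move=> lv; rewrite -[v]cat0s kunz3_cat //; apply: kunz3_nil. Qed.

Lemma kunz3_rcons12 u a : 1 <= a <= 2 -> kunz3 (rcons u a) <-> kunz3 u.
Proof. by move=> ha; rewrite -cats1 kunz3_cat // /letters_in /= ha. Qed.

Lemma kunz3_last w a : kunz3 (rcons w a) -> 1 <= a <= 3.
Proof. by move=> /kunz3P[+ _]; rewrite /letters_in all_rcons => /andP[]. Qed.

(** Sort by the last letter: removing a final 1 or 2 leaves a 3-Kunz word. *)
Lemma card_kunz3_rec g : card_set (kunz3_words g.+2) =
  card_set (kunz3_words g.+1) + card_set (kunz3_words g) + card_set (stressed_genus g.+2).
Proof.
have fimg a n : finite_set ((fun w => rcons w a) @` kunz3_words n).
  by apply: finite_image; apply: finite_kunz3_words.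
have -> : kunz3_words g.+2 = ((fun w => rcons w 1) @` kunz3_words g.+1 `|`
    (fun w => rcons w 2) @` kunz3_words g) `|` stressed_genus g.+2.
  apply/seteqP; split=> [w [kw wg]|w [[[u [ku ug] <-]|[u [ku ug] <-]]|[[kw _] wg]]] //=.
  - case/lastP: w kw wg => [|w a] kw; first by rewrite /word_genus big_nil.
    rewrite word_genus_rcons => wg.
    have := kunz3_last kw; case: a kw wg => [|[|[|[|a]]]] // kw wg _.
    + by left; left; exists w => //; split; [apply/(kunz3_rcons12 w (a := 1)) | lia].
    + by left; right; exists w => //; split; [apply/(kunz3_rcons12 w (a := 2)) | lia].
    by right; split; [split => //; rewrite last_rcons | rewrite word_genus_rcons].
  - by split; [apply/(kunz3_rcons12 u (a := 1)) | rewrite word_genus_rcons ug addn1].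
  - by split; [apply/(kunz3_rcons12 u (a := 2)) | rewrite word_genus_rcons ug addn2].
rewrite !card_setU ?finite_setU //; last first.
- move=> w [[u [ku ug] <-]|[u [ku ug] <-]] [[_ +] _]; by rewrite last_rcons.
- exact: finite_stressed_genus.
- by move=> w [u _ <-] [u' _] /(congr1 (last 0)); rewrite !last_rcons.
have inj a n : {in kunz3_words n &, injective (fun w => rcons w a)}.
  by move=> w1 w2 _ _ /rcons_inj[].
by rewrite !card_set_image //; apply: finite_kunz3_words.
Qed.

Lemma card_flat_rec g : card_set (flat_words g.+2) =
  card_set (flat_words g.+1) + card_set (flat_words g).
Proof.
have -> : flat_words g.+2 = (cons 1 @` flat_words g.+1 `|` cons 2 @` flat_words g).
  apply/seteqP; split=> [w [lw wg]|w [[u [lu ug] <-]|[u [lu ug] <-]]] /=.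
  - case: w lw wg => [|a w]; first by rewrite /word_genus big_nil.
    rewrite word_genus_cons /= => /andP[a12 lw] wg.
    case: a a12 wg => [|[|[|a]]] // _ wg.
      by left; exists w => //; split => //; lia.
    by right; exists w => //; split => //; lia.
  - by split => //; rewrite word_genus_cons ug.
  - by split => //; rewrite word_genus_cons ug.
have inj a n : {in flat_words n &, injective (cons a)} by move=> w1 w2 _ _ [].
rewrite card_setU ?card_set_image //; try exact: finite_flat_words.
- by apply: finite_image; apply: finite_flat_words.
- by apply: finite_image; apply: finite_flat_words.
by move=> w [u _ <-] [u' _].
Qed.

Lemma card_kunz_words g : card_set (kunz_words g) =
  card_set (kunz3_words g) + card_set (tall_words g).
Proof.
rewrite -card_setU; first last.
- by move=> w [kw _] [_ _].
- exact: finite_tall_words.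
- exact: finite_kunz3_words.
congr card_set; apply/seteqP; split=> [w [kw wg]|w [[[kw _] wg]|[kw wg _]]] //.
by case: (pselect (kunz3 w)) => k3; [left | right].
Qed.

Lemma word_genus0 w : letters_in 1 (word_genus w) w -> word_genus w = 0 -> w = [::].
Proof. by move=> lw w0; apply/eqP; rewrite -size_eq0 -leqn0 -w0; apply: size_le_genus lw. Qed.

End WordSets.

(** * The Frobenius number of a word of depth at most 3 *)

Section Events.
Local Open Scope classical_set_scope.
Implicit Types (u v w : seq nat) (g j : nat).

Lemma stressed_split w : kunz3 w ->
  letters_in 1 2 w \/ exists u v, [/\ w = u ++ v, stressed u & letters_in 1 2 v].
Proof.
elim/last_ind: w => [|w a IH] kw; first by left.
have a13 := kunz3_last kw; case: (ltnP a 3) => a3.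
  have a12 : 1 <= a <= 2 by move: a13 => /andP[-> _].
  have kw' : kunz3 w by apply/(kunz3_rcons12 w a12).
  case: (IH kw') => [lw|[u [v [-> su lv]]]].
    by left; rewrite /letters_in all_rcons a12.
  by right; exists u, (rcons v a); split => //; rewrite ?rcons_cat // /letters_in all_rcons a12.
have a3' : a = 3 by apply/eqP; rewrite eqn_leq a3 andbT; case/andP: a13.
by right; exists (rcons w a), [::]; split; rewrite ?cats0 //; split; rewrite // last_rcons.
Qed.

Lemma flat_split w : letters_in 1 2 w ->
  w = nseq (size w) 1 \/ exists u j, w = u ++ 2 :: nseq j 1 /\ letters_in 1 2 u.
Proof.
elim/last_ind: w => [|w a IH]; first by left.
rewrite /letters_in all_rcons => /andP[a12 lw].
have snoc j : rcons (nseq j 1) 1 = nseq j.+1 1 by rewrite -cats1 -[j.+1]addn1 nseqD.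
case: a a12 => [|[|[|a]]] // _; last by right; exists w, 0; rewrite cats1.
case: (IH lw) => [->|[u [j [-> lu]]]]; first by left; rewrite snoc size_nseq.
by right; exists u, j.+1; rewrite rcons_cat rcons_cons snoc.
Qed.

Definition offset w : int := (frobenius (semigroup_of w) - 2 * (multiplicity (semigroup_of w))%:Z)%R.

Lemma stressed_size u : stressed u -> 0 < size u.
Proof. by case: u => // -[_ /=]. Qed.

Lemma stressed_coord u : stressed u -> coord u (size u) = 3.
Proof. by move=> [_ <-]; rewrite /coord -(nth_last 0); case: u => // a u. Qed.

Lemma frobenius_above w F : kunz w -> ~ semigroup_of w F ->
  (forall n, F < n -> semigroup_of w n) -> frobenius (semigroup_of w) = F%:Z%R.
Proof. by move=> /semigroup_of_kunz[_ _ fin]; apply: frobenius_eq. Qed.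

Lemma coord_bound hi w i : letters_in 1 hi w -> coord w i <= hi.
Proof.
move=> /letters_inP lw; case: (posnP i) => [->//|i0].
case: (leqP i (size w)) => iw; last by rewrite coord_over.
by have := lw i; rewrite i0 iw => /(_ isT)/andP[].
Qed.

(** The Frobenius number is [2 m + size u]: this number is missing because of
    the final 3 of [u], and all later positions carry letters at most 2. *)
Lemma offset_stressed u v : stressed u -> letters_in 1 2 v -> offset (u ++ v) = (size u)%:Z%R.
Proof.
move=> su lv; have [ku _] := su.
have kuv : kunz3 (u ++ v) by apply/(kunz3_cat u lv).
have [kw _] := kuv.
set w := u ++ v; set m := (size w).+1.
have um : size u < m by rewrite ltnS size_cat leq_addr.
rewrite /offset semigroup_of_multiplicity // (@frobenius_above w (2 * m + size u)) //.
- by rewrite PoszD PoszM; lia.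
- by move/(semigroup_ofE 2 um); rewrite coord_cat_l // stressed_coord.
move=> n hn; rewrite /semigroup_of /= -/m.
have nm := divn_eq n m; have im : n %% m < m by rewrite ltn_mod.
have [q3|q3] := leqP 3 (n %/ m).
  by apply: leq_trans q3; apply: coord_bound; have /kunz3P[] := kuv.
have q2 : n %/ m = 2.
  apply/eqP; rewrite eqn_leq -ltnS q3 leq_divRL //.
  by apply: leq_trans (ltnW hn); rewrite leq_addr.

have iu : size u < n %% m by move: hn; rewrite {1}nm q2 ltn_add2l.
rewrite q2 /w coord_cat_r //.
have iv : n %% m - (size u).+1 < size v.
  by rewrite ltn_subLR // addSn ltnS -size_cat -ltnS.
by case/(letters_in_nth lv)/andP: iv.
Qed.

(** The Frobenius number is [m + size u + 1], because of the last 2. *)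
Lemma offset_flat u j : letters_in 1 2 u -> offset (u ++ 2 :: nseq j 1) = (- j.+1%:Z)%R.
Proof.
move=> lu; set w := u ++ _; set m := (size w).+1.
have lw : letters_in 1 2 w.
  by rewrite /letters_in all_cat [all _ u]lu /= all_nseq orbT.
have [kw _] := kunz3_flat lw.
have sw : size w = size u + j.+1 by rewrite size_cat /= size_nseq.
have um : (size u).+1 < m by rewrite /m sw; lia.
rewrite /offset semigroup_of_multiplicity // (@frobenius_above w (1 * m + (size u).+1)) //.
- by rewrite -/m /m sw; lia.
- by move/(semigroup_ofE 1 um); rewrite coord_cat_r // subnn.
move=> n hn; rewrite /semigroup_of /= -/m.
have nm := divn_eq n m; have im : n %% m < m by rewrite ltn_mod.
have [q2|q2] := leqP 2 (n %/ m).
  by apply: leq_trans q2; apply: coord_bound lw.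
have q1 : n %/ m = 1.
  apply/eqP; rewrite eqn_leq -ltnS q2 leq_divRL //.
  by apply: leq_trans (ltnW hn); rewrite leq_addr.
have ui : (size u).+1 < n %% m by move: hn; rewrite {1}nm q1 ltn_add2l.
rewrite q1 /w coord_cat_r; last by apply: ltnW.
have [k ->] : exists k, n %% m - (size u).+1 = k.+1.
  by exists (n %% m - (size u).+2); rewrite -[RHS]subSn // subSS.
by rewrite /= nth_nseq; case: ifP.
Qed.

(** The one flat word for each length that has no 2; its offset tends to
    minus infinity with the genus and so does not affect the limit. *)
Lemma offset_ones j : 0 < j -> offset (nseq j 1) = (- j.+2%:Z)%R.
Proof.
move=> j0; set w := nseq j 1.
have sw : size w = j by rewrite size_nseq.
have lw : letters_in 1 2 w by rewrite /letters_in /w all_nseq orbT.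
have [kw _] := kunz3_flat lw.
rewrite /offset semigroup_of_multiplicity // (@frobenius_above w j) //.
- by rewrite sw; lia.
- move/semigroup_of_lt; rewrite sw ltnS leqnn => /(_ isT).
  rewrite /coord /w; case: (j) j0 => // k _.
  by rewrite -[nth _ _ _]/(nth 0 (nseq k.+1 1) k) nth_nseq ltnSn.
move=> n jn; rewrite /semigroup_of /= sw.
have -> : coord w (n %% j.+1) <= n %/ j.+1 = true; last by [].
apply: (@leq_trans 1); last by rewrite leq_divRL // mul1n.
by rewrite /coord /w; case: (n %% j.+1) => // i; rewrite /= nth_nseq; case: ifP.
Qed.

Lemma offset_nil : offset [::] = (- 3%:Z)%R.
Proof.
have [kw _] := kunz3_nil.
rewrite /offset semigroup_of_multiplicity // /frobenius.
suff -> : conductor (semigroup_of [::]) = 0 by [].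
apply: min_set_eq => // n; rewrite /semigroup_of /= modn1 //.
Qed.

Lemma finite_stressed_words k : finite_set (stressed_words k).
Proof.
apply: (@sub_finite_set _ _ [set` short_words 3 k]); last exact: finite_seq.
move=> w /= [[/kunz3P[lw _] _] sw]; apply: mem_short_words; first by rewrite sw.
by apply: sub_all lw => a /andP[_ ->].
Qed.

(** The prefix [u] ends at the last 3; the rest is free in the letters 1, 2. *)
Lemma count_offset_pos k (s : seq (seq nat)) g : uniq s ->
  (forall u, stressed_words k u <-> u \in s) ->
  0 < k -> (forall u, u \in s -> word_genus u <= g) ->
  card_set [set w | kunz3_words g w /\ offset w = k%:Z%R] =
  \sum_(u <- s) card_set (flat_words (g - word_genus u)).
Proof.
move=> us sE k0 sg.
have [F FP] := choice (fun n => finite_set_enum (finite_flat_words n)).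
have sk u : u \in s -> size u = k by move/sE => [].
rewrite (@card_set_seq _ _ [seq u ++ v | u <- s, v <- F (g - word_genus u)]).
- rewrite size_allpairs_dep sumnE big_map; apply: eq_bigr => u _.
  by case: (FP (g - word_genus u)).
- apply: allpairs_uniq_dep => // [u _|]; first by case: (FP (g - word_genus u)).
  move=> [u v] [u' v'] /allpairsPdep[u1 [v1 [u1s _ [-> ->]]]] /allpairsPdep[u2 [v2 [u2s _ [-> ->]]]] /=.
  by move/eqP; rewrite eqseq_cat ?(sk u1) ?(sk u2) // => /andP[/eqP -> /eqP ->].
move=> w; split=> [[[kw wg] ow]|/allpairsPdep[u [v [us' vF ->]]]].
  have [lw|[u [v [wE su lv]]]] := stressed_split kw.
    have [w1|[u [j [wE lu]]]] := flat_split lw; last first.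
      by move: ow; rewrite wE offset_flat //; lia.
    move: ow; rewrite w1; case: (posnP (size w)) => [->|s0]; first by rewrite offset_nil; lia.
    by rewrite offset_ones //; lia.
  move: ow; rewrite wE offset_stressed // => -[uk].
  have us' : u \in s by apply/sE; split.
  apply/allpairsPdep; exists u, v; split => //.
  case: (FP (g - word_genus u)) => _ h _; apply/h; split => //.
  by rewrite -wg wE word_genus_cat addKn.
have [su uk] : stressed_words k u by apply/sE.
case: (FP (g - word_genus u)) => _ h _; move: vF => /h[lv vg].
have [ku _] := su.
split; last by rewrite offset_stressed // uk.
split; first by apply/(kunz3_cat u lv).
by rewrite word_genus_cat vg subnKC // sg.
Qed.

Lemma count_offset_neg j g : j + 2 < g ->
  card_set [set w | kunz3_words g w /\ offset w = (- j.+1%:Z)%R] =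
  card_set (flat_words (g - (j + 2))).
Proof.
move=> jg.
pose f u := u ++ 2 :: nseq j 1.
have gf u : word_genus (f u) = word_genus u + (j + 2).
  by rewrite word_genus_cat word_genus_cons word_genus_nseq muln1 addnC [2 + j]addnC addnC.
rewrite -(@card_set_image _ _ f (flat_words (g - (j + 2)))); first last.
- move=> u1 u2 _ _ f12; have := congr1 size f12; rewrite !size_cat => /addIn s12.
  by move/eqP: f12; rewrite eqseq_cat // => /andP[/eqP].
- exact: finite_flat_words.
congr card_set; apply/seteqP; split=> [w [[kw wg] ow]|w [u [lu ug] <-]] /=; last first.
  split; last by rewrite offset_flat.
  split; last by rewrite gf ug; lia.
  by apply: kunz3_flat; rewrite /letters_in all_cat [all _ u]lu /= all_nseq orbT.
have [lw|[u [v [wE su lv]]]] := stressed_split kw; last first.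
  by move: ow; rewrite wE offset_stressed //; lia.
have [w1|[u [i [wE lu]]]] := flat_split lw; last first.
  move: ow; rewrite wE offset_flat // => ij; have {}ij : i = j by lia.
  exists u; last by rewrite /f ij.
  by split => //; rewrite -wg wE ij -/(f u) gf; lia.
have gs : g = size w by rewrite -wg {1}w1 word_genus_nseq muln1.
have s0 : 0 < size w by rewrite -gs (leq_ltn_trans _ jg).
by exfalso; move: ow; rewrite w1 offset_ones // -gs; move: jg; clear; lia.
Qed.

Lemma count_offset_zero g : card_set [set w | kunz3_words g w /\ offset w = 0%R] = 0.
Proof.
rewrite (@card_set_seq _ _ [::]) // => w; split=> // -[[kw wg] ow].
have [lw|[u [v [wE su lv]]]] := stressed_split kw; last first.
  by move: ow; rewrite wE offset_stressed //; have := stressed_size su; lia.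
have [w1|[u [i [wE lu]]]] := flat_split lw; last first.
  by move: ow; rewrite wE offset_flat //; lia.
move: ow; rewrite w1; case: (posnP (size w)) => [->|s0]; first by rewrite offset_nil; lia.
by rewrite offset_ones //; lia.
Qed.

Lemma semigroups_image g : semigroups g = semigroup_of @` kunz_words g.
Proof.
apply/seteqP; split=> [L [sL gL]|L [w [kw wg] <-]].
  exists (word_of L); last exact: semigroup_of_word_of.
  split; first exact: kunz_word_of.
  by rewrite -semigroup_of_genus semigroup_of_word_of.
by split; [apply: semigroup_of_kunz | rewrite semigroup_of_genus].
Qed.

Lemma semigroups_card g (P : set (set nat)) :
  card_set (semigroups g `&` P) = card_set [set w | kunz_words g w /\ P (semigroup_of w)].
Proof.
rewrite -(@card_set_image _ _ semigroup_of); first last.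
- by move=> w1 w2; rewrite !inE => -[[k1 _] _] [[k2 _] _]; apply: semigroup_of_inj; rewrite inE.
- by apply: sub_finite_set (finite_kunz_words g) => w [].
congr card_set; rewrite semigroups_image; apply/seteqP; split=> [L [[w kw <-] Pw]|L [w [kw Pw] <-]].
  by exists w.
by split => //; exists w.
Qed.

Lemma t_card g : t_ g = card_set (kunz3_words g).
Proof.
rewrite /t_ -[[set L | _]]/(semigroups g `&` [set L | (depth L <= 3)%R]) semigroups_card.
congr card_set; apply/seteqP; split=> [w [[kw wg]] /= /(semigroup_of_depth kw) h|w [kw3 wg]].
  split => //; split => // i iw; rewrite letterE; [exact: h | by case/andP: iw].
have [kw _] := kw3; split => //=; apply/(semigroup_of_depth kw) => i.
by apply: coord_bound; have /kunz3P[] := kw3.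
Qed.

(** The integer [s_g] of the definition counts the stressed words of genus [g]. *)
Lemma s_card g : s_ g.+2 = (card_set (stressed_genus g.+2))%:Z%R.
Proof.
rewrite /s_ !t_card subn1 subn2 /= card_kunz3_rec; lia.
Qed.

End Events.

(** * Weighted sums over functions on a finite set *)

Local Open Scope ring_scope.

Section WeightedSums.
Variable R : realFieldType.
Implicit Types (V L I : finType).

(** Product sets are the only sets of words whose weight is computed exactly;
    all other bounds cover a set of words by boxes. *)
Lemma box_sum V L (wt : L -> R) (Om : pred {ffun V -> L}) (P : V -> pred L) :
  (forall a, 0 <= wt a) ->
  (forall f, Om f -> forall v, P v (f v)) ->
  \sum_(f | Om f) \prod_v wt (f v) <= \prod_v \sum_(a | P v a) wt a.
Proof.
move=> wt0 OmP; rewrite bigA_distr_big_dep big_mkcond [leRHS]big_mkcond /=.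
apply: ler_sum => f _.
have w0 : 0 <= \prod_v wt (f v) by apply: prodr_ge0.
case: ifP => Of; last by case: ifP.
by rewrite ifT //; apply/familyP => v; apply: OmP.
Qed.

Lemma cover_sum I (T : finType) (F : T -> R) (Om : pred T) (B : I -> pred T)
    (P : pred I) (K : R) :
  (forall t, 0 <= F t) -> 
  (forall t, Om t -> exists2 i, P i & B i t) ->
  (forall i, P i -> \sum_(t | Om t && B i t) F t <= K) ->
  \sum_(t | Om t) F t <= \sum_(i | P i) K.
Proof.
move=> F0 OmB Ble; apply: (@le_trans _ _ (\sum_(i | P i) \sum_(t | Om t && B i t) F t)).
  rewrite (exchange_big_dep Om) /=; last by move=> i t _ /andP[].
  apply: ler_sum => t Ot; have [i Pi Bit] := OmB t Ot.
  rewrite (bigD1 i) /=; last by rewrite Pi Ot Bit.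
  by rewrite lerDl sumr_ge0.
exact: ler_sum.
Qed.

(** Comparison with the generating function of all subsets by size at [y]. *)
Lemma sum_small_sets V (P : pred {set V}) (y K : R) :
  0 < y ->
  (forall X, P X -> 1 <= K * y ^+ #|X|) -> 0 <= K ->
  \sum_(X : {set V} | P X) 1 <= K * (1 + y) ^+ #|V|.
Proof.
move=> y0 PX K0.
have -> : (1 + y) ^+ #|V| = \sum_(X : {set V}) y ^+ #|X|.
  rewrite -[LHS]prodr_const; under eq_bigr do rewrite addrC.
  rewrite (bigA_distr _ _ (fun=> y) (fun=> 1)); apply: eq_bigr => X _.
  by rewrite -big_mkcond prodr_const.
rewrite mulr_sumr big_mkcond; apply: ler_sum => X _; case: ifP => [/PX//|_].
by rewrite mulr_ge0 // exprn_ge0 // ltW.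
Qed.

(** A product bound for constraints along the orbits of an involution [tau].
    The pair bound is split as [k v * k (tau v)] so that the result is a product
    over all points, which is convenient when the bound depends on whether none,
    one or both of the points of a pair lie in some set.  Exceptional points cost
    a factor [C] each.  The proof encodes a function by its pairs of values at
    one representative of each orbit, and drops the constraints on the code. *)
Lemma pair_sum V L (wt : L -> R) (Om : pred {ffun V -> L}) (tau : V -> V)
   (E : {set V}) (Pr : V -> L -> L -> bool) (k : V -> R) (C : R) :
  V -> L ->
  (forall a, 0 <= wt a) -> (forall v, 0 <= k v) ->
  involutive tau -> (forall v, (tau v \in E) = (v \in E)) ->
  (forall v, tau v = v -> v \in E) ->
  (forall f v, Om f -> v \notin E -> Pr v (f v) (f (tau v))) ->
  (forall v, v \notin E ->
     \sum_a \sum_(b | Pr v a b) wt a * wt b <= k v * k (tau v)) ->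
  (forall v, \sum_a wt a <= C * k v) ->
  \sum_(f | Om f) \prod_v wt (f v) <= C ^+ #|E| * \prod_v k v.
Proof.
move=> v0 a0 wt0 k0 tauK tauE fixE OmPr sumPr sumC.
pose rep v := (v \notin E) && (enum_rank v < enum_rank (tau v))%N.
pose norep v := (v \notin E) && (enum_rank (tau v) < enum_rank v)%N.
have trich v : [\/ [/\ v \in E, ~~ rep v & ~~ norep v],
                   [/\ v \notin E, rep v & ~~ norep v] |
                   [/\ v \notin E, ~~ rep v & norep v]].
  rewrite /rep /norep; case: (boolP (v \in E)) => vE /=; first by constructor 1.
  case: (ltngtP (enum_rank v) (enum_rank (tau v))) => h.
  - by constructor 2.
  - by constructor 3.
  - by move/val_inj/enum_rank_inj/esym/fixE: h; rewrite (negPf vE).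
have split_prod (g : V -> R) : \prod_v g v =
    \prod_(v | v \in E) g v * \prod_(v | rep v) (g v * g (tau v)).
  rewrite (bigID (fun v => v \in E)) /=; congr (_ * _).
  rewrite (bigID rep) /= big_split /=; congr (_ * _).
    by apply: eq_bigl => v; rewrite /rep andbA andbb.
  rewrite (reindex_inj (can_inj tauK)) /=; apply: eq_bigl => v.
  rewrite /rep !tauE tauK; have := trich v; rewrite /rep /norep.
  by case: (v \in E) => //=; case: ltngtP => // ?; case=> -[].
(* Off the chosen representatives the code is the dummy value [(a0, a0)]. *)
pose H (f : {ffun V -> L}) : {ffun V -> L * L} :=
  [ffun v => if v \in E then (f v, a0) else
             if rep v then (f v, f (tau v)) else (a0, a0)].
pose g v (p : L * L) : R :=
  if v \in E then wt p.1 *+ (p.2 == a0) else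
  if rep v then (wt p.1 * wt p.2) *+ Pr v p.1 p.2 else
  (p == (a0, a0))%:R.
have g0 v p : 0 <= g v p.
  rewrite /g; case: ifP => _; first by rewrite mulrn_wge0.
  by case: ifP => _; rewrite ?ler0n // mulrn_wge0 // mulr_ge0.
have Hinj : injective H.
  move=> f1 f2 /ffunP eqf; apply/ffunP => v.
  have := eqf v; rewrite !ffunE.
  case: (trich v) => -[vE r nr]; first by rewrite vE => -[].
    by rewrite (negPf vE) r => -[].
  move=> _; have := eqf (tau v); rewrite !ffunE tauE (negPf vE).
  have -> : rep (tau v) by move: nr; rewrite /norep /rep tauE tauK.
  by rewrite tauK => -[].
have HE f : Om f -> \prod_v wt (f v) = \prod_v g v (H f v).
  move=> Of; rewrite split_prod [RHS](bigID (fun v => v \in E)) /=; congr (_ * _).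
    by apply: eq_bigr => v vE; rewrite /g ffunE vE /= eqxx.
  rewrite [RHS](bigID rep) /= [X in _ = _ * X]big1 ?mulr1.
    apply: eq_big => [v|v]; first by rewrite /rep andbA andbb.
    move=> rv; rewrite /g ffunE rv /=.
    have vE : v \notin E by case/andP: rv.
    by rewrite (negPf vE) /= OmPr.
  by move=> v /andP[vE rv]; rewrite /g ffunE (negPf vE) (negPf rv) eqxx.
apply: (@le_trans _ _ (\sum_(h : {ffun V -> L * L}) \prod_v g v (h v))).
  rewrite (eq_bigr (fun f => \prod_v g v (H f v)) HE) /=.
  rewrite -(big_imset (fun h : {ffun V -> L * L} => \prod_v g v (h v))) /=;
    last by move=> ? ? _ _; apply: Hinj.
  rewrite big_mkcond /=; apply: ler_sum => h _; case: ifP => // _.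
  exact: prodr_ge0.
rewrite -bigA_distr_bigA /= split_prod.
have -> : C ^+ #|E| * \prod_v k v =
   \prod_(v in E) (C * k v) * \prod_(v | rep v) (k v * k (tau v)).
  by rewrite split_prod mulrA -prodr_const -big_split.
have sumE v : v \in E -> \sum_p g v p = \sum_a wt a.
  move=> vE; rewrite -(pair_bigA _ (fun a b => g v (a, b))) /=.
  apply: eq_bigr => a _; rewrite (bigD1 a0) //= /g vE /= eqxx mulr1n big1 ?addr0 //.
  by move=> b /negPf ->.
have sumR v : rep v -> \sum_p g v p = \sum_a \sum_(b | Pr v a b) wt a * wt b.
  move=> rv; have vE : v \notin E by case/andP: rv.
  rewrite -(pair_bigA _ (fun a b => g v (a, b))) /=.
  apply: eq_bigr => a _; rewrite [RHS]big_mkcond; apply: eq_bigr => b _.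
  by rewrite /g rv (negPf vE) /= mulrb.
have sumN v : v \notin E -> ~~ rep v -> \sum_p g v p = 1.
  move=> vE rv; rewrite (bigD1 (a0, a0)) //= /g (negPf vE) (negPf rv) eqxx.
  by rewrite big1 ?addr0 // => p /negPf ->.
rewrite ler_pM ?prodr_ge0 //.
- by move=> v _; apply: sumr_ge0.
- by move=> v _; rewrite mulr_ge0 ?sumr_ge0.
- by apply: ler_prod => v vE; rewrite sumr_ge0 //= sumE.
apply: ler_prod => v rv.
have vE : v \notin E by case/andP: rv.
rewrite mulr_ge0 ?sumr_ge0 //= sumR // sumN ?mulr1 ?sumPr ?tauE //.
by move: rv; rewrite /rep tauE tauK => /andP[_]; case: ltngtP; rewrite ?andbF.
Qed.

End WeightedSums.

(** * Containers for the positions of a letter *)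

Section Container.
Variables (V : finType) (e : rel V).

Definition nbrs v := [set j | e v j].
Definition nbhd (T : {set V}) := \bigcup_(v in T) nbrs v.

(** Take [T] of maximal cardinality among the subsets of [A] that satisfy
    [s * #|T| <= #|nbhd T|].  If some [v] in [A] had [s] new neighbours, then
    [T] could be enlarged by [v]. *)
Lemma fingerprint (A : {set V}) s : (0 < s)%N ->
  exists T : {set V}, [/\ T \subset A, (s * #|T| <= #|V|)%N &
    forall v, v \in A -> (#|nbrs v :\: nbhd T| < s)%N].
Proof.
move=> s0.
pose P (T : {set V}) := (T \subset A) && (s * #|T| <= #|nbhd T|)%N.
have P0 : P finset.set0 by rewrite /P finset.sub0set cards0 muln0.
case: (arg_maxnP (fun T : {set V} => #|T|) P0) => T /andP[TA Tn] Tmax.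
exists T; split => //; first by apply: leq_trans Tn (max_card _).
move=> v vA; rewrite ltnNge; apply/negP => sv.
have vT : v \notin T.
  apply/negP => vT; move: sv; have /eqP -> : #|nbrs v :\: nbhd T| == 0%N.
    by rewrite cards_eq0 finset.setD_eq0 /nbhd (bigcup_max v).
  by rewrite leqNgt s0.
have : (#|v |: T|%SET <= #|T|)%N.
  apply: Tmax; rewrite /P finset.subUset finset.sub1set vA TA cardsU1 vT /=.
  have -> : nbhd (v |: T)%SET = ((nbrs v :\: nbhd T) :|: nbhd T)%SET.
    rewrite /nbhd finset.bigcup_setU big_set1; apply/setP => j; rewrite !inE.
    by case: (j \in \bigcup_(_ in _) _); rewrite ?orbT ?orbF.
  rewrite mulnDr muln1 finset.cardsU.
  suff -> : ((nbrs v :\: nbhd T) :&: nbhd T)%SET = finset.set0.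
    by rewrite cards0 subn0 leq_add.
  by apply/setP => j; rewrite !inE; case: (j \in nbhd T); rewrite ?andbF.
by rewrite cardsU1 vT ltnn.
Qed.

(** Double counting of the edges between [D] and [F]. *)
Lemma edge_count (D F : {set V}) a d :
  (forall v, v \in D -> (a <= #|nbrs v :&: F|)%N) ->
  (forall f, (#|[set v | e v f]| <= d)%N) ->
  (#|D| * a <= d * #|F|)%N.
Proof.
move=> Da Fd.
rewrite -sum_nat_const mulnC -sum_nat_const.
apply: (@leq_trans (\sum_(v in D) \sum_(f in F) e v f)).
  apply: leq_sum => v vD; apply: leq_trans (Da v vD) _.
  rewrite -sum1_card [leqRHS]big_mkcond [leqLHS]big_mkcond /=; apply: leq_sum => f _.
  by rewrite !inE; case: (e v f); case: (f \in F).
rewrite exchange_big /=; apply: leq_sum => f _; apply: leq_trans (Fd f).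
rewrite -sum1_card [leqRHS]big_mkcond [leqLHS]big_mkcond /=; apply: leq_sum => v _.
by rewrite !inE; case: (v \in D); case: (e v f).
Qed.

End Container.

Lemma leq_remove s a b : (b < s -> 16 * s <= a + b -> 15 * s <= a)%N.
Proof. lia. Qed.

Section ContainerSum.
Variable R : realFieldType.

(** Exponents in the ratio [p : q] are the worst case: a relative excess of the
    factors [b <= 1] over that ratio only helps.  No roots are taken. *)
Lemma ratio_pow (p q : nat) (a b : R) u f : (0 < q)%N ->
  1 <= a -> 0 <= b -> a ^+ p * b ^+ q <= 1 ->
  (q * u <= p * f)%N -> a ^+ u * b ^+ f <= 1.
Proof.
move=> q0 a1 b0 ab uf.
have a0 : 0 <= a by apply: le_trans ler01 a1.
suff : (a ^+ u * b ^+ f) ^+ q <= 1.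
  by rewrite expr_le1 // mulr_ge0 ?exprn_ge0.
rewrite exprMn -!exprM mulnC [(f * q)%N]mulnC.
apply: (@le_trans _ _ ((a ^+ p * b ^+ q) ^+ f)).
  by rewrite exprMn -!exprM ler_wpM2r ?exprn_ge0 // ler_weXn2l.
by rewrite exprn_ile1 // mulr_ge0 ?exprn_ge0.
Qed.

(** Let [T] be a fingerprint of the set of positions of the letter [one] and [F]
    its neighbourhood.  Each position falls into one of four classes: in [F],
    where [QF] holds; in [S] with fewer than [s] neighbours outside [F], where
    nothing more is known; elsewhere in [S], where the letter is not [one]; and
    outside [S].  The corresponding sums over letters are bounded by [F], [U],
    [rho] and [H], up to a factor [C] at the exceptional positions in [E].  The
    positions of the second class have at least [15 s] of their [16 s] neighbours
    in [F], so they number at most [16 / 15] times [#|F|] by [edge_count]; the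
    numerical hypothesis on [U] and [F] says that at this ratio the two classes
    together weigh no more than [rho] per position.  The factor
    [(kappa * (1 + y)) ^+ #|V|] is the number of possible fingerprints. *)
Lemma container_sum (V L : finType) (e : rel V) (wt : L -> R) (one : L)
    (Om : pred {ffun V -> L}) (S E : {set V}) (s : nat) (kappa y : R)
    (Q QF : V -> pred L) (U F H rho C : R) :
  (0 < s)%N -> 1 <= kappa -> 0 < y -> 1 <= y * kappa ^+ s ->
  (forall a, 0 <= wt a) ->
  (forall v j, e v j = e j v) ->
  (forall v, (#|nbrs e v| <= 16 * s)%N) ->
  (forall v, v \in S -> (16 * s <= #|nbrs e v|)%N) ->
  (forall w v, Om w -> Q v (w v)) ->
  (forall w v j, Om w -> e v j -> w v = one -> QF j (w j)) ->
  0 <= C -> 0 <= F -> 0 < rho -> rho <= U -> rho <= H ->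
  (U / rho) ^+ 16 * (F / rho) ^+ 15 <= 1 ->
  (forall v, \sum_(a | QF v a) wt a <= C ^+ (v \in E) * F) ->
  (forall v, v \in S -> \sum_(a | Q v a) wt a <= C ^+ (v \in E) * U) ->
  (forall v, v \in S -> \sum_(a | Q v a && (a != one)) wt a <= C ^+ (v \in E) * rho) ->
  (forall v, v \notin S -> \sum_(a | Q v a) wt a <= C ^+ (v \in E) * H) ->
  \sum_(w | Om w) \prod_v wt (w v) <=
    (kappa * (1 + y)) ^+ #|V| * (C ^+ #|E| * (rho ^+ #|S| * H ^+ (#|V| - #|S|))).
Proof.
move=> s0 k1 y0 yk wt0 esym edge Sdeg OmQ OmF C0 F0 rho0 rhoU rhoH UF sF sU sR sH.
have H0 : 0 <= H by apply: le_trans (ltW rho0) rhoH.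
have U0 : 0 <= U by apply: le_trans (ltW rho0) rhoU.
have k0 : 0 <= kappa by apply: le_trans ler01 k1.
set K := C ^+ #|E| * _.
have K0 : 0 <= K by rewrite /K !mulr_ge0 ?exprn_ge0 // ltW.
pose box (T : {set V}) (v : V) (a : L) :=
  if v \in nbhd e T then QF v a else
  if v \in S then
    (if (#|nbrs e v :\: nbhd e T| < s)%N then Q v a else Q v a && (a != one))
  else Q v a.
pose B (T : {set V}) (w : {ffun V -> L}) := [forall v, box T v (w v)].
apply: (@le_trans _ _ (\sum_(T : {set V} | (s * #|T| <= #|V|)%N) K)).
  apply: (@cover_sum _ _ _ _ _ B).
  - by move=> w; apply: prodr_ge0.
  - move=> w Ow.
    have [T [TA Ts Tmax]] := fingerprint e [set v | w v == one]%SET s0.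
    exists T => //; apply/forallP => v; rewrite /box.
    case: ifP => [/bigcupP[t tT]|_].
      by rewrite inE => etv; apply: OmF Ow etv _; move/fintype.subsetP: TA => /(_ t tT); rewrite inE => /eqP.
    case: ifP => [_|_]; last exact: OmQ.
    case: ifP => h; first exact: OmQ.
    rewrite OmQ //=; apply/negP => wv; move: (Tmax v); rewrite h inE wv.
    by move=> /(_ isT).
  move=> T _.
  apply: (@le_trans _ _ (\prod_v \sum_(a | box T v a) wt a)).
    by apply: box_sum => // w /andP[_ /forallP].
  pose cl v := if v \in nbhd e T then F else if v \in S then
     (if (#|nbrs e v :\: nbhd e T| < s)%N then U else rho) else H.
  apply: (@le_trans _ _ (\prod_v (C ^+ (v \in E) * cl v))).
    apply: ler_prod => v _; rewrite sumr_ge0 //= /box /cl.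
    case: ifP => _; first exact: sF.
    case: ifPn => vS; last exact: sH.
    by case: ifP => _; [exact: sU | exact: sR].
  rewrite big_split /=; apply: ler_pM; rewrite ?prodr_ge0 //.
  - by move=> v _; rewrite exprn_ge0.
  - move=> v _; by rewrite /cl; repeat case: ifP => // _; apply: ltW.
  - by rewrite -prodr_const [leRHS]big_mkcond; apply: ler_prod => v _;
       rewrite exprn_ge0 //=; case: (v \in E).
  pose D := [set v in S | (#|nbrs e v :\: nbhd e T| < s)%N & v \notin nbhd e T]%SET.
  have DF : (#|D| * (15 * s) <= 16 * s * #|nbhd e T|)%N.
    apply: (@edge_count _ e) => [v|f].
      rewrite !inE => /and3P[vS vs _].
      by apply: (leq_remove vs); rewrite cardsID; exact: Sdeg.
    apply: leq_trans (edge f); apply: subset_leq_card; apply/fintype.subsetP => v.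
    by rewrite !inE esym.
  have {}DF : (15 * #|D| <= 16 * #|nbhd e T|)%N.
    rewrite -(leq_pmul2r s0); have -> : (15 * #|D| * s = #|D| * (15 * s))%N.
      by rewrite (mulnC 15%N) mulnA.
    by rewrite mulnAC.
  pose base v := if v \in S then rho else H.
  have -> : rho ^+ #|S| * H ^+ (#|V| - #|S|) = \prod_v base v.
    rewrite (bigID (fun v => v \in S)) /= /base.
    under eq_bigr => v vS do rewrite vS.
    rewrite prodr_const; congr (_ * _).
    under eq_bigr => v vS do rewrite (negPf vS).
    have -> : (#|V| - #|S|)%N = #|~: S|%SET by rewrite [RHS]cardsCs finset.setCK.
    by rewrite -prodr_const; apply: eq_bigl => v; rewrite !inE.
  apply: (@le_trans _ _ (\prod_v (base v * ((U / rho) ^+ (v \in D) * (F / rho) ^+ (v \in nbhd e T))))).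
    apply: ler_prod => v _; apply/andP; split.
      by by rewrite /cl; repeat case: ifP => // _; apply: ltW.
    rewrite /cl /base inE; case: ifP => vF.
      rewrite !andbF expr0 mul1r expr1; case: ifP => _.
        by rewrite mulrC divfK ?lt0r_neq0.
      by rewrite mulrA ler_pdivlMr // mulrC ler_wpM2r.
    case: ifP => vS /=; last by rewrite !mulr1.
    case: ifP => _; rewrite /= !expr0 ?expr1 ?mulr1 //.
    by rewrite mulrC divfK ?lt0r_neq0.
  rewrite !big_split /= ler_piMr ?prodr_ge0 //.
    by move=> v _; rewrite /base; case: ifP => // _; apply: ltW.
  have powcard (a : R) (X : {set V}) : \prod_v a ^+ (v \in X) = a ^+ #|X|.
    by rewrite -prodr_const [RHS]big_mkcond; apply: eq_bigr => v _; case: (v \in X).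
  rewrite !powcard; apply: (@ratio_pow 16 15) => //.
    by rewrite ler_pdivlMr // mul1r.
  by rewrite divr_ge0 // ltW.
have -> : \sum_(T : {set V} | (s * #|T| <= #|V|)%N) K =
   (\sum_(T : {set V} | (s * #|T| <= #|V|)%N) 1) * K.
  by rewrite mulr_suml; apply: eq_bigr => *; rewrite mul1r.
rewrite ler_wpM2r // exprMn; apply: sum_small_sets => //; last exact: exprn_ge0.
move=> T sT; apply: (@le_trans _ _ ((y * kappa ^+ s) ^+ #|T|)).
  by rewrite exprn_ege1.
by rewrite exprMn mulrC -exprM ler_wpM2r ?exprn_ge0 ?(ltW y0) // ler_weXn2l.
Qed.

End ContainerSum.

(** * Weights of letters and of pairs of letters *)

Section LetterWeights.
Variables (R : realFieldType) (x : R).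
Hypotheses (x_gt0 : 0 < x) (x_sq : x ^+ 2 = 1 - x).

Lemma x_bounds : 55 / 89 < x < 89 / 144.
Proof. by move: x_gt0 x_sq => h1 h2; apply/andP; split; nra. Qed.

Lemma x_powers :
  (x ^+ 3 = 2 * x - 1) * (x ^+ 4 = 2 - 3 * x) * (x ^+ 5 = 5 * x - 3) *
  (x ^+ 6 = 5 - 8 * x) * (x ^+ 7 = 13 * x - 8) * (x ^+ 8 = 13 - 21 * x) *
  (x ^+ 9 = 34 * x - 21) * (x ^+ 10 = 34 - 55 * x) * (x ^+ 11 = 89 * x - 55) *
  (x ^+ 12 = 89 - 144 * x).
Proof.
have step n (a b : R) : x ^+ n = a + b * x -> x ^+ n.+1 = b + (a - b) * x.
  by move=> h; rewrite exprS h mulrDr mulrCA -expr2 x_sq; ring.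
have h2 : x ^+ 2 = 1 + (-1) * x by rewrite x_sq; ring.
have h3 := step _ _ _ h2. have h4 := step _ _ _ h3. have h5 := step _ _ _ h4.
have h6 := step _ _ _ h5. have h7 := step _ _ _ h6. have h8 := step _ _ _ h7.
have h9 := step _ _ _ h8. have h10 := step _ _ _ h9. have h11 := step _ _ _ h10.
have h12 := step _ _ _ h11.
by do !split; rewrite ?h3 ?h4 ?h5 ?h6 ?h7 ?h8 ?h9 ?h10 ?h11 ?h12; ring.
Qed.

(** Letters come from an ordinal type of arbitrary size; the sums to be
    evaluated have a fixed finite range. *)
Lemma sum_trunc (G N : nat) (f : nat -> R) : (forall a, 0 <= f a) ->
  (forall a, (N <= a)%N -> f a = 0) ->
  \sum_(a < G) f a <= \sum_(0 <= a < N) f a.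
Proof.
move=> f0 fN; rewrite -(big_mkord xpredT f).
have [GN|NG] := leqP G N.
  by rewrite (big_cat_nat (leq0n G) GN) //= lerDl sumr_ge0.
rewrite (big_cat_nat (leq0n N) (ltnW NG)) //= [X in _ + X]big1_seq ?addr0 // => a.
by rewrite mem_index_iota => /andP[_ /andP[/fN]].
Qed.

Lemma letter_sum (G N : nat) (P : pred nat) : (forall a, P a -> (a < N)%N) ->
  \sum_(a < G | P a) x ^+ a <= \sum_(0 <= a < N) (if P a then x ^+ a else 0).
Proof.
move=> PN; rewrite big_mkcond /=.
apply: (@sum_trunc G N (fun a => if P a then x ^+ a else 0)) => a.
  by case: ifP => // _; rewrite exprn_ge0 // ltW.
by move=> Na; case: ifP => // /PN; rewrite ltnNge Na.
Qed.

Lemma letter_pair_sum (G N : nat) (P : nat -> nat -> bool) :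
  (forall a b, P a b -> (a < N) && (b < N))%N ->
  \sum_(a < G) \sum_(b < G | P a b) x ^+ a * x ^+ b <=
  \sum_(0 <= a < N) \sum_(0 <= b < N) (if P a b then x ^+ (a + b) else 0).
Proof.
move=> PN.
have xp n : 0 <= x ^+ n by rewrite exprn_ge0 // ltW.
pose F a := \sum_(0 <= b < N) (if P a b then x ^+ (a + b) else 0).
apply: (@le_trans _ _ (\sum_(a < G) F a)).
  apply: ler_sum => a _; rewrite big_mkcond /=.
  apply: le_trans (@sum_trunc G N (fun b => if P a b then x ^+ (a + b) else 0) _ _).
  - by apply: ler_sum => b _; rewrite exprD.
  - by move=> b; case: ifP.
  - by move=> b Nb; case: ifP => // /PN/andP[_]; rewrite ltnNge Nb.
apply: (@sum_trunc G N F) => a.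
  by apply: sumr_ge0 => b _; case: ifP.
move=> Na; rewrite /F big1 // => b _; case: ifP => // /PN/andP[].
by rewrite ltnNge Na.
Qed.

Ltac letter_eval := rewrite /index_iota /= ?big_cons ?big_nil /=
   ?expr0 ?expr1 ?x_sq ?x_powers; have /andP[? ?] := x_bounds; lra.

Lemma geometric_le1 G : (1 - x) * \sum_(a < G) x ^+ a <= 1.
Proof.
have -> : (1 - x) * \sum_(a < G) x ^+ a = 1 - x ^+ G.
  by apply: oppr_inj; rewrite opprB subrX1 -mulNr opprB.
by rewrite gerBl exprn_ge0 // ltW.
Qed.

(** The exact supremum is the square of the golden ratio. *)
Lemma sum_letters (G : nat) : \sum_(a < G) x ^+ a <= 8 / 3.
Proof.
have /andP[b1 b2] := x_bounds.
have S0 : 0 <= \sum_(a < G) x ^+ a by apply: sumr_ge0 => a _; rewrite exprn_ge0 // ltW.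
move: (geometric_le1 G) S0; set S := \sum_(a < G) _ => h S0.
have h' : 3 / 8 * S <= 1 by apply: le_trans h; rewrite ler_wpM2r //; lra.
lra.
Qed.

Definition between (lo hi a : nat) := (lo <= a <= hi)%N.

Definition pair_ok (h1 h2 s a b : nat) := [&& between 1 h1 a, between 1 h2 b & s <= a + b]%N.

Lemma letters13 G : \sum_(a < G | between 1 3 a) x ^+ a <= 31 / 25.
Proof.
apply: le_trans (@letter_sum G 4 (between 1 3) _) _ => [a|]; first by case/andP.
by letter_eval.
Qed.

Lemma letters23 G : \sum_(a < G | between 2 3 a) x ^+ a <= 31 / 50.
Proof.
apply: le_trans (@letter_sum G 4 (between 2 3) _) _ => [a|]; first by case/andP.
by letter_eval.
Qed.

Lemma letters12 G : \sum_(a < G | between 1 2 a) x ^+ a <= 1.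
Proof.
apply: le_trans (@letter_sum G 3 (between 1 2) _) _ => [a|]; first by case/andP.
by letter_eval.
Qed.

Lemma letters14 G : \sum_(a < G | between 1 4 a) x ^+ a <= 139 / 100.
Proof.
apply: le_trans (@letter_sum G 5 (between 1 4) _) _ => [a|]; first by case/andP.
by letter_eval.
Qed.

Lemma letters24 G : \sum_(a < G | between 2 4 a) x ^+ a <= 77 / 100.
Proof.
apply: le_trans (@letter_sum G 5 (between 2 4) _) _ => [a|]; first by case/andP.
by letter_eval.
Qed.

Lemma letters15 G : \sum_(a < G | between 1 5 a) x ^+ a <= 37 / 25.
Proof.
apply: le_trans (@letter_sum G 6 (between 1 5) _) _ => [a|]; first by case/andP.
by letter_eval.
Qed.

Lemma letters35 G : \sum_(a < G | between 3 5 a) x ^+ a <= 12 / 25.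
Proof.
apply: le_trans (@letter_sum G 6 (between 3 5) _) _ => [a|]; first by case/andP.
by letter_eval.
Qed.

Lemma letters25 G : \sum_(a < G | between 2 5 a) x ^+ a <= 43 / 50.
Proof.
apply: le_trans (@letter_sum G 6 (between 2 5) _) _ => [a|]; first by case/andP.
by letter_eval.
Qed.

Lemma letters34 G : \sum_(a < G | between 3 4 a) x ^+ a <= 31 / 50.
Proof.
apply: le_trans (@letter_sum G 5 (between 3 4) _) _ => [a|]; first by case/andP.
by letter_eval.
Qed.

Lemma pairs333 G : \sum_(a < G) \sum_(b < G | pair_ok 3 3 3 a b) x ^+ a * x ^+ b <= 27 / 25 * (27 / 25).
Proof.
apply: le_trans (@letter_pair_sum G 4 (pair_ok 3 3 3) _) _ => [a b|].
  by rewrite /pair_ok /between; lia.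
by letter_eval.
Qed.

Lemma pairs323 G : \sum_(a < G) \sum_(b < G | pair_ok 3 2 3 a b) x ^+ a * x ^+ b <= 27 / 25 * (4 / 5).
Proof.
apply: le_trans (@letter_pair_sum G 4 (pair_ok 3 2 3) _) _ => [a b|].
  by rewrite /pair_ok /between; lia.
by letter_eval.
Qed.

Lemma pairs233 G : \sum_(a < G) \sum_(b < G | pair_ok 2 3 3 a b) x ^+ a * x ^+ b <= 4 / 5 * (27 / 25).
Proof.
apply: le_trans (@letter_pair_sum G 4 (pair_ok 2 3 3) _) _ => [a b|].
  by rewrite /pair_ok /between; lia.
by letter_eval.
Qed.

Lemma pairs223 G : \sum_(a < G) \sum_(b < G | pair_ok 2 2 3 a b) x ^+ a * x ^+ b <= 4 / 5 * (4 / 5).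
Proof.
apply: le_trans (@letter_pair_sum G 3 (pair_ok 2 2 3) _) _ => [a b|].
  by rewrite /pair_ok /between; lia.
by letter_eval.
Qed.

Lemma pairs444 G : \sum_(a < G) \sum_(b < G | pair_ok 4 4 4 a b) x ^+ a * x ^+ b <= 37 / 36 * (37 / 36).
Proof.
apply: le_trans (@letter_pair_sum G 5 (pair_ok 4 4 4) _) _ => [a b|].
  by rewrite /pair_ok /between; lia.
by letter_eval.
Qed.

Lemma pairs434 G : \sum_(a < G) \sum_(b < G | pair_ok 4 3 4 a b) x ^+ a * x ^+ b <= 37 / 36 * (15 / 16).
Proof.
apply: le_trans (@letter_pair_sum G 5 (pair_ok 4 3 4) _) _ => [a b|].
  by rewrite /pair_ok /between; lia.
by letter_eval.
Qed.

Lemma pairs344 G : \sum_(a < G) \sum_(b < G | pair_ok 3 4 4 a b) x ^+ a * x ^+ b <= 15 / 16 * (37 / 36).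
Proof.
apply: le_trans (@letter_pair_sum G 5 (pair_ok 3 4 4) _) _ => [a b|].
  by rewrite /pair_ok /between; lia.
by letter_eval.
Qed.

Lemma pairs334 G : \sum_(a < G) \sum_(b < G | pair_ok 3 3 4 a b) x ^+ a * x ^+ b <= 15 / 16 * (15 / 16).
Proof.
apply: le_trans (@letter_pair_sum G 4 (pair_ok 3 3 4) _) _ => [a b|].
  by rewrite /pair_ok /between; lia.
by letter_eval.
Qed.

Lemma pairs555 G : \sum_(a < G) \sum_(b < G | pair_ok 5 5 5 a b) x ^+ a * x ^+ b <= 15 / 16 * (15 / 16).
Proof.
apply: le_trans (@letter_pair_sum G 6 (pair_ok 5 5 5) _) _ => [a b|].
  by rewrite /pair_ok /between; lia.
by letter_eval.
Qed.

Lemma pairs666 G : \sum_(a < G) \sum_(b < G | pair_ok 6 6 6 a b) x ^+ a * x ^+ b <= 15 / 16 * (15 / 16).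
Proof.
apply: le_trans (@letter_pair_sum G 7 (pair_ok 6 6 6) _) _ => [a b|].
  by rewrite /pair_ok /between; lia.
by letter_eval.
Qed.

(** The whole tail from [t + 2] on sums to [x ^ (t + 2) / (1 - x) = x ^ t]. *)
Lemma tail_sum G t : \sum_(a < G | (t.+2 <= a)%N) x ^+ a <= x ^+ t.
Proof.
have xp n : 0 <= x ^+ n by rewrite exprn_ge0 // ltW.
have -> : x ^+ t = x ^+ t * 1 by rewrite mulr1.
apply: le_trans (ler_wpM2l (xp t) (geometric_le1 G)).
rewrite mulrA -x_sq -exprD addn2 mulr_sumr.
rewrite -(big_mkord (fun a => t.+2 <= a)%N (fun a => x ^+ a)).
have [Gt|tG] := leqP G t.+2.
  rewrite big1_seq; first by apply: sumr_ge0 => a _; apply: mulr_ge0.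
  by move=> a /andP[ta]; rewrite mem_index_iota => /andP[_ aG]; lia.
rewrite (big_cat_nat (leq0n t.+2) (ltnW tG)) /= big1_seq ?add0r; last first.
  by move=> a /andP[ta]; rewrite mem_index_iota => /andP[_ aG]; lia.
rewrite -{1}[t.+2]add0n big_addn.
rewrite -(big_mkord xpredT (fun a => x ^+ t.+2 * x ^+ a)).
rewrite (big_cat_nat (leq0n (G - t.+2)) (leq_subr _ _)) /=.
rewrite big_mkcond /= -[leLHS]addr0; apply: lerD; last by apply: sumr_ge0 => a _; apply: mulr_ge0.
by apply: ler_sum => a _; rewrite -exprD addnC; case: ifP.
Qed.

(** For an unbounded second letter the sum over it is a tail sum; with
    both letters unbounded the double sum is [4 x ^ 4 + x ^ 2]. *)
Lemma pairs_large G :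
  \sum_(a < G) \sum_(b < G | [&& 1 <= a, 1 <= b & 6 <= a + b]%N) x ^+ a * x ^+ b
    <= 99 / 100 * (99 / 100).
Proof.
have xp n : 0 <= x ^+ n by rewrite exprn_ge0 // ltW.
have inner (a t : nat) : (forall b, [&& 1 <= a, 1 <= b & 6 <= a + b]%N -> (t.+2 <= b)%N) ->
  \sum_(b < G | [&& 1 <= a, 1 <= b & 6 <= a + b]%N) x ^+ a * x ^+ b <= x ^+ a * x ^+ t.
  move=> h; rewrite -mulr_sumr ler_wpM2l //; apply: le_trans (tail_sum G t).
  rewrite big_mkcond [leRHS]big_mkcond /=; apply: ler_sum => b _.
  by case: ifP => [/h ->//|_]; case: ifP.
have first_two : \sum_(b < G | (1 <= b)%N) x ^+ b <= 1 + x.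
  rewrite (bigID (fun b : 'I_G => 2 <= b)%N) /= lerD //.
    apply: le_trans (tail_sum G 0); rewrite big_mkcond [leRHS]big_mkcond /=.
    by apply: ler_sum => b _; case: ifP => [/andP[_ ->]//|_]; case: ifP.
  under eq_bigl => b do rewrite -ltnNge ltnS.
  apply: le_trans (@letter_sum G 2 (between 1 1) _) _ => [a /andP[]//|].
  by rewrite /index_iota /= !big_cons big_nil /= add0r addr0.
pose f1 a : R := if between 1 4 a then x ^+ 4 else 0.
pose f2 a : R := if (5 <= a)%N then x ^+ a else 0.
apply: (@le_trans _ _ (\sum_(a < G) (f1 a + f2 a * (1 + x)))).
  apply: ler_sum => -[a aG] _ /=; rewrite /f1 /f2.
  case: a {aG} => [|[|[|[|[|a]]]]].
  - by rewrite big1 // mul0r addr0.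
  - apply: le_trans (@inner 1%N 3%N _) _ => [b|]; first lia.
    by rewrite /= mul0r addr0 -exprD.
  - apply: le_trans (@inner 2%N 2%N _) _ => [b|]; first lia.
    by rewrite /= mul0r addr0 -exprD.
  - apply: le_trans (@inner 3%N 1%N _) _ => [b|]; first lia.
    by rewrite /= mul0r addr0 -exprD.
  - apply: le_trans (@inner 4%N 0%N _) _ => [b|]; first lia.
    by rewrite /= mul0r addr0 -exprD.
  rewrite /= add0r -mulr_sumr ler_wpM2l //.
  apply: le_trans first_two; rewrite big_mkcond [leRHS]big_mkcond /=.
  by apply: ler_sum => b _; case: ifP => [/andP[-> _]//|_]; case: ifP.
rewrite big_split /= -mulr_suml.
have h1 : \sum_(a < G) f1 a <= 4 * x ^+ 4.
  apply: le_trans (@sum_trunc G 5 f1 _ _) _.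
  - by move=> a; rewrite /f1; case: ifP.
  - by move=> a a5; rewrite /f1 /between; case: ifP => // /andP[_]; lia.
  by rewrite /f1 /index_iota /= ?big_cons ?big_nil /=; lra.
have h2 : \sum_(a < G) f2 a <= x ^+ 3.
  by rewrite /f2 -big_mkcond; apply: tail_sum.
have h3 : (\sum_(a < G) f2 a) * (1 + x) <= x ^+ 3 * (1 + x).
  by rewrite ler_wpM2r // addr_ge0 // ltW.
apply: le_trans (lerD h1 h3) _; rewrite mulrDr mulr1 -exprSr !x_powers.
have /andP[] := x_bounds; lra.
Qed.

End LetterWeights.

(** * Reflections of the index set *)

(** The positions are the residues modulo [m.+1], with position 0 carrying the
    letter 0.  The mate of [v] with respect to [b] is [b - v] in the additive
    group of residues; it lies below or above [b] as [v] does, and the sum of the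
    two representatives is [b] or [b + m.+1] accordingly. *)
Section Mates.
Variable m : nat.
Implicit Types (b v j : 'I_m.+1).

Lemma mate_le b v : (v <= b)%N -> (v + (b - v)%R)%N = b.
Proof.
move=> vb; rewrite /= modnDmr.
have -> : (b + (m.+1 - v) = (b - v) + m.+1)%N by have := ltn_ord v; lia.
by rewrite modnDr modn_small ?subnKC // (leq_ltn_trans (leq_subr _ _)).
Qed.

Lemma mate_gt b v : (b < v)%N -> (v + (b - v)%R)%N = (b + m.+1)%N.
Proof.
move=> bv; rewrite /= modnDmr modn_small; have := ltn_ord v; lia.
Qed.

Lemma mate_leq b v : ((b - v)%R <= b)%N = (v <= b)%N.
Proof.
have [vb|bv] := leqP v b; first by rewrite -[X in (_ <= X)%N](mate_le vb) leq_addl.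
have := mate_gt bv; have := ltn_ord v => h1 h2; apply/negbTE; rewrite -ltnNge; lia.
Qed.

Lemma mate_uniq b v j : (v + j = b)%N -> j = b - v.
Proof.
move=> vjb; apply: val_inj => /=; have := @mate_le b v; rewrite /= => h.
by apply: (@addnI v); rewrite h // -vjb leq_addr.
Qed.

Lemma mate_inj v : injective (fun b => b - v).
Proof. by move=> b1 b2 /(congr1 (+%R^~ v)); rewrite !subrK. Qed.

Lemma mate_fix b : (#|[set v : 'I_m.+1 | (b - v)%R == v]| <= 2)%N.
Proof.
rewrite -card_bool -(card_in_imset (f := fun v : 'I_m.+1 => (v <= b)%N)); first exact: max_card.
move=> v1 v2; rewrite !inE => /eqP h1 /eqP h2 hle; apply: val_inj => /=.
have [vb|bv] := leqP v1 b.
  have := mate_le vb; have : (v2 <= b)%N by rewrite -hle.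
  by move=> /mate_le; rewrite h1 h2; lia.
have := mate_gt bv; have : (b < v2)%N by rewrite ltnNge -hle -ltnNge.
by move=> /mate_gt; rewrite h1 h2; lia.
Qed.

Lemma card_below c : (c <= m.+1)%N -> #|[set v : 'I_m.+1 | (v < c)%N]| = c.
Proof.
move=> cm; rewrite -[RHS]card_ord -(card_imset _ (f := widen_ord cm)) //; last first.
  by move=> i j /(congr1 val) ij; apply: val_inj.
apply: eq_card => v; rewrite !inE; apply/idP/imsetP => [vc|[i _ ->]] /=; last exact: ltn_ord.
by exists (Ordinal vc) => //; apply: val_inj.
Qed.

(** A final segment with exactly [d] elements of [X], or with all of [X] if there
    are fewer: moving [c] by one changes the count by at most one. *)
Lemma last_block (X : {set 'I_m.+1}) d : exists c : 'I_m.+2,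
  (#|[set v in X | c <= v]| <= d)%N /\
  (c = 0%N :> nat \/ #|[set v in X | c <= v]| = d)%N.
Proof.
pose f c := #|[set v in X | (c <= v)%N]|.
have ex : exists c, (f c <= d)%N.
  exists m.+1; rewrite /f (_ : [set v in X | _]%SET = finset.set0) ?cards0 //.
  by apply/setP => v; rewrite !inE leqNgt ltn_ord andbF.
case: (ex_minnP ex) => c fc cmin.
have cm : (c < m.+2)%N.
  rewrite ltnS; apply: cmin; rewrite /f (_ : [set v in X | _]%SET = finset.set0) ?cards0 //.
  by apply/setP => v; rewrite !inE leqNgt ltn_ord andbF.
exists (Ordinal cm); split => //=.
case: c fc cmin cm => [|c] fc cmin cm; [by left | right].
apply/eqP; rewrite eqn_leq fc /=.
have : (d < f c)%N by rewrite ltnNge; apply/negP => /cmin; rewrite ltnn.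
suff h : (f c <= (f c.+1).+1)%N by move=> dc; rewrite -ltnS; apply: leq_trans dc h.
have cm1 : (c < m.+1)%N by [].
rewrite /f; apply: (@leq_trans #|(Ordinal cm1) |: [set v in X | (c.+1 <= v)%N]|%SET).
  apply: subset_leq_card; apply/fintype.subsetP => v; rewrite !inE.
  case/andP => -> /=; rewrite leq_eqVlt => /orP[/eqP e|->]; last by rewrite orbT.
  by apply/orP; left; apply/eqP/val_inj.
by rewrite cardsU1; case: (_ \notin _); rewrite ?add1n ?add0n.
Qed.

End Mates.

(** * Coverings by few sets of words *)

Section Cases.
Variables (R : realFieldType) (x : R).
Hypotheses (x_gt0 : 0 < x) (x_sq : x ^+ 2 = 1 - x).

(** The exponential rate that is conceded for each choice of a position, of a
    set of bounded size or of a fingerprint. *)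
Definition eps : R := 1 / 4000.

Lemma eps_gt0 : 0 < eps. Proof. rewrite /eps; lra. Qed.
Lemma eps_le1 : eps <= 1. Proof. rewrite /eps; lra. Qed.

(** Bernoulli's inequality: a linear factor costs a rate [1 + eps] only. *)
Lemma le_exp_eps n : n.+1%:R <= eps^-1 * (1 + eps) ^+ n :> R.
Proof.
have e0 := eps_gt0; have e1 := eps_le1.
rewrite -(@ler_pM2l _ eps) // mulVKf ?lt0r_neq0 //.
elim: n => [|n IH]; first by rewrite expr0 mulr1.
rewrite -natr1 mulrDr mulr1 exprS mulrDl mul1r lerD // ler_peMr ?(ltW e0) //.
by rewrite exprn_ege1 // lerDl ltW.
Qed.

Lemma point_factor_ge0 n (K : R) : 0 <= K -> 0 <= eps^-1 * (1 + eps) ^+ n * K.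
Proof.
have e0 := ltW eps_gt0.
by move=> K0; rewrite mulr_ge0 // mulr_ge0 ?invr_ge0 // exprn_ge0 // addr_ge0.
Qed.

Lemma set_factor_ge0 d n (K : R) : 0 <= K -> 0 <= (eps ^+ d)^-1 * (1 + eps) ^+ n * K.
Proof.
have e0 := ltW eps_gt0.
move=> K0; rewrite mulr_ge0 // mulr_ge0 //.
  by rewrite invr_ge0 exprn_ge0.
by rewrite exprn_ge0 // addr_ge0.
Qed.

Lemma cover_points (T I : finType) (F : T -> R) (Om : pred T) (B : I -> pred T) (K : R) n :
  (forall t, 0 <= F t) -> 0 <= K -> (#|I| <= n.+1)%N ->
  (forall t, Om t -> exists i, B i t) ->
  (forall i, \sum_(t | Om t && B i t) F t <= K) ->
  \sum_(t | Om t) F t <= eps^-1 * (1 + eps) ^+ n * K.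
Proof.
move=> F0 K0 In OmB Ble.
apply: (@le_trans _ _ (\sum_(i : I) K)).
  by apply: (cover_sum (B := B)) => // t /OmB[i ?]; exists i.
rewrite sumr_const -mulr_natl ler_wpM2r //.
by apply: le_trans (le_exp_eps n); rewrite ler_nat.
Qed.

Lemma cover_small_sets (T V : finType) (F : T -> R) (Om : pred T)
    (B : {set V} -> pred T) (K : R) d n :
  (forall t, 0 <= F t) -> 0 <= K -> #|V| = n ->
  (forall t, Om t -> exists2 X : {set V}, (#|X| <= d)%N & B X t) ->
  (forall X : {set V}, (#|X| <= d)%N -> \sum_(t | Om t && B X t) F t <= K) ->
  \sum_(t | Om t) F t <= (eps ^+ d)^-1 * (1 + eps) ^+ n * K.
Proof.
move=> F0 K0 <- OmB Ble.
have ed : 0 < eps ^+ d by rewrite exprn_gt0 // eps_gt0.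
apply: (@le_trans _ _ (\sum_(X : {set V} | (#|X| <= d)%N) K)).
  exact: (cover_sum (B := B)).
have -> : \sum_(X : {set V} | (#|X| <= d)%N) K = (\sum_(X : {set V} | (#|X| <= d)%N) 1) * K.
  by rewrite mulr_suml; apply: eq_bigr => *; rewrite mul1r.
rewrite ler_wpM2r //; apply: sum_small_sets; first exact: eps_gt0.
  move=> X Xd; rewrite mulrC ler_pdivlMr // mul1r.
  by rewrite ler_wiXn2l ?eps_le1 ?(ltW eps_gt0).
by rewrite invr_ge0 ltW.
Qed.

Section Words.
Variables m G : nat.
Notation V := 'I_m.+1.
Notation W := {ffun 'I_m.+1 -> 'I_G.+2}.
Implicit Types (w : W) (p v b i j : V) (Om : pred W).

Definition weight w := \prod_v x ^+ w v.

Lemma weight_ge0 w : 0 <= weight w.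
Proof. by apply: prodr_ge0 => v _; rewrite exprn_ge0 // ltW. Qed.

Lemma prod_levels (c : nat) (k1 k2 : R) : (c <= m.+1)%N ->
  \prod_(v : V) (if (v < c)%N then k1 else k2) = k1 ^+ c * k2 ^+ (m.+1 - c).
Proof.
move=> cm; rewrite (bigID (fun v : V => v < c)%N) /=; congr (_ * _).
  under eq_bigr => v vc do rewrite vc.
  rewrite prodr_const -[in RHS](card_below cm); congr (_ ^+ _).
  by apply: eq_card => v; rewrite inE.
under eq_bigr => v vc do rewrite (negPf vc).
rewrite prodr_const; congr (_ ^+ _).
rewrite -[in RHS](card_below cm) -[X in (X - _)%N](card_ord m.+1).
have <- : (#|~: [set v : V | (v < c)%N]%SET| = #|V| - #|[set v : V | (v < c)%N]%SET|)%N.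
  by rewrite [LHS]cardsCs finset.setCK.
by apply: eq_card => v; rewrite !inE.
Qed.

(** [pair_sum] for the reflection through [p], with exceptional set [E].  This set
    has to be closed under the reflection, and the at most two fixed points are
    exceptional as well; hence the exponent [2 * n + 2]. *)
Lemma pair_case (p : V) (E : {set V}) (n : nat) Om (Pr : V -> nat -> nat -> bool) (k : V -> R) :
  (#|E| <= n)%N ->
  (forall w v, Om w -> v \notin E -> (p - v)%R \notin E -> Pr v (w v) (w (p - v)%R)) ->
  (forall v, \sum_(a < G.+2) \sum_(b < G.+2 | Pr v a b) x ^+ a * x ^+ b
              <= k v * k (p - v)%R) ->
  (forall v, 4 / 5 <= k v) ->
  \sum_(w | Om w) weight w <= 4 ^+ (2 * n + 2) * \prod_v k v.
Proof.
move=> En OmPr sumPr kv.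
have k0 v : 0 <= k v by apply: le_trans (kv v); lra.
pose tau v := (p - v)%R.
have tauK : involutive tau by move=> v; rewrite /tau subKr.
(* The factor 4 at exceptional points: all letters together weigh at most
   [8 / 3 <= 4 * (4 / 5) <= 4 * k v]. *)
pose E' := (E :|: tau @: E :|: [set v | tau v == v])%SET.
have mem_tau v : (v \in tau @: E) = (tau v \in E).
  by rewrite -{1}[v]tauK mem_imset //; apply: can_inj tauK.
have E'n : (#|E'| <= 2 * n + 2)%N.
  apply: leq_trans (leq_card_setU _ _) _; apply: leq_add; last exact: mate_fix.
  apply: leq_trans (leq_card_setU _ _) _.
  by rewrite mul2n -addnn leq_add // (leq_trans (leq_imset_card _ _)).
rewrite /weight; apply: (@le_trans _ _ (4 ^+ #|E'| * \prod_v k v)).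
  apply: (@pair_sum R V _ (fun a : 'I_G.+2 => x ^+ a) Om tau E' (fun v a a' => Pr v a a')) => //.
  - exact: ord0.
  - by move=> a; rewrite exprn_ge0 // ltW.
  - move=> v; rewrite !inE !mem_tau tauK eq_sym [X in X || _]orbC; congr (_ || _).
  - by move=> v h; rewrite !inE h eqxx orbT.
  - move=> w v Ow; rewrite !inE mem_tau !negb_or => /andP[/andP[vE tE] _].
    exact: OmPr.
  - by move=> v; apply: le_trans (sum_letters x_gt0 x_sq _) _; have := kv v; lra.
rewrite ler_wpM2r ?prodr_ge0 // ler_weXn2l //; lra.
Qed.

End Words.
End Cases.

(** * Words with a letter at least 6, and the container bound *)

Lemma between_pred r top a : between 1 top a -> (r <= 1 + a)%N -> between r.-1 top a.
Proof. rewrite /between; lia. Qed.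

Section WordCases.
Variables (R : realFieldType) (x : R).
Hypotheses (x_gt0 : 0 < x) (x_sq : x ^+ 2 = 1 - x).
Variable s : nat.
Hypotheses (s_gt0 : (0 < s)%N) (s_large : 1 <= eps R * (1 + eps R) ^+ s).
Variables m G : nat.
Notation V := 'I_m.+1.
Notation W := {ffun 'I_m.+1 -> 'I_G.+2}.
Implicit Types (w : W) (p v b i j : V) (Om : pred W) (B E : {set V}).
Local Notation eps := (eps R).
Local Notation weight := (weight x).
Local Notation d := (16 * s)%N.

(** Position 0 stands for the residue class 0. *)
Definition zero_headed w := w 0 = 0%N :> nat /\ forall v, v != 0 -> (0 < w v)%N.

(** A letter at least 7 at [p] leaves pairs with sum at least 6 everywhere. *)
Lemma case_large Om :
  (forall w, Om w -> zero_headed w /\ exists p, forall v, (6 <= w v + w (p - v)%R)%N) ->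
  \sum_(w | Om w) weight w <=
    eps^-1 * (1 + eps) ^+ m.+1 * (4 ^+ 4 * (99 / 100) ^+ m.+1).
Proof.
move=> OmP.
apply: (cover_points (I := V) (B := fun p w => [forall v, (6 <= w v + w (p - v)%R)%N])).
- by move=> w; apply: weight_ge0.
- by rewrite mulr_ge0 ?exprn_ge0.
- by rewrite card_ord ltnW.
- by move=> w /OmP[_ [p h]]; exists p; apply/forallP.
move=> p.
have -> : (99 / 100) ^+ m.+1 = \prod_(v : V) (99 / 100) :> R.
  by rewrite prodr_const card_ord.
apply: (@pair_case _ _ x_gt0 x_sq m G p [set 0]%SET 1 _
         (fun _ a c => [&& 1 <= a, 1 <= c & 6 <= a + c]%N)).
- by rewrite cards1.
- move=> w v /andP[/OmP[[_ w_pos] _] /forallP h]; rewrite !inE => v0 pv0.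
  by rewrite !w_pos ?h.
- by move=> v; apply: pairs_large.
- by move=> _; lra.
Qed.

(** With [p] the last 6, the pairs to the right of [p] have letters at most 5. *)
Lemma case_six Om :
  (forall w, Om w -> zero_headed w /\ exists p, forall v,
     if (v <= p)%N then (w v <= 6)%N && (6 <= w v + w (p - v)%R)%N
     else (w v <= 5)%N && (5 <= w v + w (p - v)%R)%N) ->
  \sum_(w | Om w) weight w <=
    eps^-1 * (1 + eps) ^+ m.+1 * (4 ^+ 4 * (15 / 16) ^+ m.+1).
Proof.
move=> OmP.
pose six p w v : bool := if (v <= p)%N then (w v <= 6)%N && (6 <= w v + w (p - v)%R)%N
     else (w v <= 5)%N && (5 <= w v + w (p - v)%R)%N.
apply: (cover_points (I := V) (B := fun p w => [forall v, six p w v])).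
- by move=> w; apply: weight_ge0.
- by rewrite mulr_ge0 ?exprn_ge0.
- by rewrite card_ord ltnW.
- by move=> w /OmP[_ [p h]]; exists p; apply/forallP.
move=> p.
have -> : (15 / 16) ^+ m.+1 = \prod_(v : V) (15 / 16) :> R.
  by rewrite prodr_const card_ord.
apply: (@pair_case _ _ x_gt0 x_sq m G p [set 0]%SET 1 _
         (fun v a c => if (v <= p)%N then pair_ok 6 6 6 a c else pair_ok 5 5 5 a c)).
- by rewrite cards1.
- move=> w v /andP[/OmP[[_ w_pos] _] /forallP h]; rewrite !inE => v0 pv0.
  move: (h v) (h (p - v)); rewrite /six mate_leq /pair_ok /between !w_pos //.
  by case: ifP => _ /andP[-> ->] /andP[-> _].
- by move=> v; case: (v <= p)%N; [exact: pairs666 | exact: pairs555].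
- by move=> _; lra.
Qed.

(** [i] and [j] are adjacent if [i + j] is in [B] as a natural number: only the
    reflections of points to the left of the centre are used. *)
Definition lower_edge B i j := [exists b, (b \in B) && (i + j == b)%N].

Lemma lower_nbrs B i : nbrs (lower_edge B) i \subset [set b - i | b in B]%SET.
Proof.
apply/fintype.subsetP => j; rewrite inE => /existsP[b /andP[bB /eqP ijb]].
by apply/imsetP; exists b => //; apply: mate_uniq.
Qed.

Lemma lower_nbrs_full B i : (forall b, b \in B -> (i <= b)%N) ->
  nbrs (lower_edge B) i = [set b - i | b in B]%SET.
Proof.
move=> iB; apply/eqP; rewrite finset.eqEsubset lower_nbrs /=.
apply/fintype.subsetP => j /imsetP[b bB ->]; rewrite inE.
by apply/existsP; exists b; rewrite bB mate_le ?iB /=.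
Qed.

(** [container_sum] for the reflections through the [d] positions of [B] with
    letters at least [r].  All of [B] lies at or to the right of [c], so the
    positions to the left of [c] have full degree [d].  A neighbour of a letter 1
    carries a letter at least [r - 1]. *)
Lemma lower_container (c : nat) B E (r top n : nat) Om (U F H rho : R) :
  (c <= m.+1)%N -> #|B| = d -> (forall b, b \in B -> (c <= b)%N) ->
  (1 < r)%N -> (#|E| <= n)%N -> 
  (forall w i j b, Om w -> b \in B -> (i + j = b)%N -> (r <= w i + w j)%N) ->
  (forall w v, Om w -> v \notin E -> between 1 top (w v)) ->
  (forall w v, Om w -> v \notin E -> (c <= v)%N -> between 1 r.-1 (w v)) ->
  1 / 3 <= F -> 1 / 3 <= rho -> rho <= U -> rho <= H ->
  (U / rho) ^+ 16 * (F / rho) ^+ 15 <= 1 ->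
  \sum_(a < G.+2 | between 1 top a) x ^+ a <= U ->
  \sum_(a < G.+2 | between r.-1 top a) x ^+ a <= F ->
  \sum_(a < G.+2 | between 2 top a) x ^+ a <= rho ->
  \sum_(a < G.+2 | between 1 r.-1 a) x ^+ a <= H ->
  \sum_(w | Om w) weight w <=
    ((1 + eps) * (1 + eps)) ^+ m.+1 * (8 ^+ n * (rho ^+ c * H ^+ (m.+1 - c))).
Proof.
move=> cm Bd Bc r1 En OmB OmT OmH F3 rho3 rhoU rhoH UF sU sF sR sH.
pose Q v (a : 'I_G.+2) := (v \in E) || (if (c <= v)%N then between 1 r.-1 a else between 1 top a).
pose QF v (a : 'I_G.+2) := (v \in E) || between r.-1 top a.
have rho0 : 0 < rho by apply: lt_le_trans rho3; rewrite divr_gt0.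
have F0 : 0 <= F by apply: le_trans F3; rewrite divr_ge0.
have U3 : 1 / 3 <= U by apply: le_trans rhoU.
have H3 : 1 / 3 <= H by apply: le_trans rhoH.
have H0 : 0 <= H by apply: le_trans H3; rewrite divr_ge0.
have e1 : 1 <= 1 + eps by rewrite lerDl ltW // eps_gt0.
(* The factor 8 at exceptional positions: all letters together weigh at most
   [8 / 3], and every class has a bound of at least [1 / 3]. *)
have sall (P : pred 'I_G.+2) (K : R) : 1 / 3 <= K -> \sum_(a | P a) x ^+ a <= 8 ^+ true * K.
  move=> K3; apply: (@le_trans _ _ (8 / 3)).
    apply: le_trans (sum_letters x_gt0 x_sq G.+2); rewrite big_mkcond /=.
    by apply: ler_sum => a _; case: ifP => // _; rewrite exprn_ge0 // ltW.
  by rewrite expr1 -[8 / 3]mulr1 mulrAC -mulrA ler_wpM2l // mulrC.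
rewrite /weight.
apply: (@le_trans _ _ (((1 + eps) * (1 + eps)) ^+ #|V| *
   (8 ^+ #|E| * (rho ^+ #|[set v : V | (v < c)%N]%SET| *
    H ^+ (#|V| - #|[set v : V | (v < c)%N]%SET|))))).
  apply: (@container_sum _ V _ (lower_edge B) (fun a : 'I_G.+2 => x ^+ a) (inord 1)
    Om [set v : V | (v < c)%N]%SET E s _ _ Q QF U F) => //; rewrite ?eps_gt0 //.
  - by move=> a; rewrite exprn_ge0 // ltW.
  - by move=> i j; apply: eq_existsb => b; rewrite addnC.
  - move=> i; rewrite -Bd; apply: leq_trans (subset_leq_card (lower_nbrs B i)) _.
    exact: leq_imset_card.
  - move=> i; rewrite inE => ic; rewrite lower_nbrs_full; last first.
      by move=> b /Bc; apply: leq_trans; apply: ltnW.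
    by rewrite card_imset ?Bd //; apply: mate_inj.
  - move=> w v Ow; rewrite /Q; case: (boolP (v \in E)) => //= vE.
    by case: ifP => cv; [apply: OmH | apply: OmT].
  - move=> w i j Ow /existsP[b /andP[bB /eqP ijb]] wi.
    rewrite /QF; case: (boolP (j \in E)) => //= jE.
    have := OmB _ _ _ _ Ow bB ijb; have := OmT w j Ow jE.
    by rewrite wi inordK //; apply: between_pred.
  - move=> v; rewrite /QF; case: (boolP (v \in E)) => [vE|vE]; first exact: sall.
    by rewrite expr0 mul1r.
  - move=> v; rewrite inE /Q => vc; case: (boolP (v \in E)) => [vE|vE]; first exact: sall.
    by rewrite expr0 mul1r leqNgt vc.
  - move=> v; rewrite inE /Q => vc; case: (boolP (v \in E)) => [vE|vE]; first exact: sall.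
    rewrite expr0 mul1r leqNgt vc /=; apply: le_trans sR.
    rewrite big_mkcond [leRHS]big_mkcond /=; apply: ler_sum => a _.
    case: ifP => [/andP[h a1]|_]; last by case: ifP => // _; rewrite exprn_ge0 // ltW.
    rewrite ifT //; move: h; rewrite /between => /andP[h ->]; rewrite andbT ltn_neqAle h andbT.
    by apply: contra a1 => /eqP h1; apply/eqP/val_inj; rewrite /= inordK.
  - move=> v; rewrite inE -leqNgt /Q => vc; case: (boolP (v \in E)) => [vE|vE]; first exact: sall.
    by rewrite expr0 mul1r vc.
rewrite card_ord card_below // ler_wpM2l ?exprn_ge0 ?mulr_ge0 ?addr_ge0 ?(ltW (eps_gt0 R)) //.
rewrite ler_wpM2r ?mulr_ge0 ?exprn_ge0 ?(ltW rho0) // ler_weXn2l // (ler1n R 8) //.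
Qed.

(** Four squarings evaluate [(a b) ^ 16]; the rounding after each of them keeps
    the numbers small. *)
Lemma pow16_le1 (a b t1 t2 t3 : R) : 0 <= a -> 0 < b ->
  (a * b) * (a * b) <= t1 -> t1 * t1 <= t2 -> t2 * t2 <= t3 -> t3 * t3 <= b ->
  a ^+ 16 * b ^+ 15 <= 1.
Proof.
move=> a0 b0 h1 h2 h3 h4.
have ab0 : 0 <= a * b by rewrite mulr_ge0 // ltW.
have sq (t u v : R) : 0 <= t -> t <= u -> u * u <= v -> t ^+ 2 <= v.
  by move=> t0 tu; apply: le_trans; rewrite expr2 ler_pM.
rewrite -(@ler_pM2r _ b) // mul1r -mulrA -exprSr -exprMn.
have -> : (a * b) ^+ 16 = (((a * b) ^+ 2) ^+ 2 ^+ 2) ^+ 2 by rewrite -!exprM.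
apply: (sq _ t3) h4; first by rewrite !exprn_ge0.
apply: (sq _ t2) h3; first by rewrite !exprn_ge0.
by apply: (sq _ t1) h2; rewrite ?exprn_ge0 ?expr2.
Qed.

(** A product of two rates of which the larger one, [k1], applies to a limited
    proportion [p / (p + q)] of the [n] positions. *)
Lemma two_rates (k1 k2 r : R) (p q : nat) c n : 0 < r -> r <= k1 -> 0 <= k2 ->
  (0 < q)%N -> k1 ^+ p * k2 ^+ q <= r ^+ (p + q) -> (c <= n)%N -> (q * c <= p * (n - c))%N ->
  k1 ^+ c * k2 ^+ (n - c) <= r ^+ n.
Proof.
move=> r0 rk1 k20 q0 h cn hc.
have rn k : 0 < r ^+ k by rewrite exprn_gt0.
rewrite -[leRHS]mul1r -ler_pdivrMr //.
have -> : r ^+ n = r ^+ c * r ^+ (n - c) by rewrite -exprD subnKC.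
rewrite invfM mulrACA -!expr_div_n.
apply: (@ratio_pow _ p q) => //.
- by rewrite ler_pdivlMr // mul1r.
- by rewrite divr_ge0 // ltW.
by rewrite !expr_div_n mulrACA -invfM -exprD ler_pdivrMr // mul1r.
Qed.

End WordCases.

(** * Words with largest letter 3, 4 or 5 *)

Lemma not_top r a c v : ~~ ((r <= a) && (c <= v))%N -> (c <= v)%N -> (a <= r.-1)%N.
Proof. move=> h cv; move: h; rewrite cv andbT; lia. Qed.

Lemma below_half c n : (2 * c <= n -> 1 * c <= 1 * (n - c))%N.
Proof. lia. Qed.

Lemma above_half c n : (n < 2 * c -> c <= n -> 1 * (n - c) <= 1 * (n - (n - c)))%N.
Proof. lia. Qed.

Lemma below_two_thirds c n : (3 * c <= 2 * n -> 1 * c <= 2 * (n - c))%N.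
Proof. lia. Qed.

Lemma above_two_thirds c n :
  (2 * n < 3 * c -> c <= n -> 2 * (n - c) <= 1 * (n - (n - c)))%N.
Proof. lia. Qed.

Lemma le_double2 n : (n <= 2 * n + 2)%N.
Proof. lia. Qed.

Section Certificates.
Variable R : realFieldType.

(** In the next three lemmas the numerators of [(U / rho)] and [(F / rho)] bound
    the sums over the letters that are possible at a free position and at a
    neighbour of a 1. *)
Lemma certificate_three :
  ((31 / 25 : R) / (9 / 10)) ^+ 16 * ((31 / 50) / (9 / 10)) ^+ 15 <= 1.
Proof. apply: (@pow16_le1 _ _ _ (91 / 100) (83 / 100) (69 / 100)); lra. Qed.

Lemma certificate_four :
  ((139 / 100 : R) / (19 / 20)) ^+ 16 * ((31 / 50) / (19 / 20)) ^+ 15 <= 1.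
Proof. apply: (@pow16_le1 _ _ _ (92 / 100) (85 / 100) (73 / 100)); lra. Qed.

Lemma certificate_five :
  ((37 / 25 : R) / (87 / 100)) ^+ 16 * ((12 / 25) / (87 / 100)) ^+ 15 <= 1.
Proof. apply: (@pow16_le1 _ _ _ (89 / 100) (80 / 100) (64 / 100)); lra. Qed.

Lemma rates_three_pair c n : (c <= n)%N -> (2 * c <= n)%N ->
  (27 / 25 : R) ^+ c * (4 / 5) ^+ (n - c) <= (19 / 20) ^+ n.
Proof.
move=> cn h; apply: (@two_rates _ _ _ _ 1 1); rewrite ?(below_half h) //; rewrite ?expr1 ?expr2; lra.
Qed.

Lemma rates_three_container c n : (c <= n)%N -> (n < 2 * c)%N ->
  (9 / 10 : R) ^+ c * 1 ^+ (n - c) <= (19 / 20) ^+ n.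
Proof.
move=> cn h; rewrite mulrC -[X in _ * _ ^+ X](subKn cn).
apply: (@two_rates _ _ _ _ 1 1); rewrite ?(above_half h cn) //; rewrite ?expr1 ?expr2 ?leq_subr //; lra.
Qed.

(** [308 / 311] is the Bernoulli lower bound for [(310 / 311) ^ 3]. *)
Lemma cube_rate (a b c : R) : 0 <= a -> 0 <= b -> a * a <= c -> c * b <= 308 / 311 ->
  a ^+ 2 * b <= (310 / 311) ^+ 3.
Proof.
move=> a0 b0 h1 h2; apply: (@le_trans _ _ (308 / 311)).
  by apply: le_trans h2; rewrite expr2 ler_wpM2r.
have -> : 310 / 311 = 1 - 1 / 311 :> R by lra.
have -> : 308 / 311 = 1 - 3 * (1 / 311) :> R by lra.
have t0 : 0 <= 1 / 311 :> R by lra.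
have t1 : 1 / 311 <= 1 :> R by lra.
by move: t0 t1; move: (1 / 311) => t; nra.
Qed.

Lemma rates_five_pair c n : (c <= n)%N -> (3 * c <= 2 * n)%N ->
  (37 / 36 : R) ^+ c * (15 / 16) ^+ (n - c) <= (310 / 311) ^+ n.
Proof.
move=> cn h.
have [r0 r1 k0] : [/\ 0 < 310 / 311 :> R, 310 / 311 <= 37 / 36 :> R & 0 <= 15 / 16 :> R].
  by split; lra.
apply: (@two_rates _ _ _ _ 2 1); rewrite ?(below_two_thirds h) //.
by rewrite expr1; apply: (@cube_rate _ _ (75 / 71)); lra.
Qed.

Lemma rates_five_container c n : (c <= n)%N -> (2 * n < 3 * c)%N ->
  (87 / 100 : R) ^+ c * (31 / 25) ^+ (n - c) <= (310 / 311) ^+ n.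
Proof.
move=> cn h; rewrite mulrC -[X in _ * _ ^+ X](subKn cn).
have [r0 r1 k0] : [/\ 0 < 310 / 311 :> R, 310 / 311 <= 31 / 25 :> R & 0 <= 87 / 100 :> R].
  by split; lra.
apply: (@two_rates _ _ _ _ 1 2); rewrite ?(above_two_thirds h cn) ?leq_subr //.
by rewrite expr1 mulrC; apply: (@cube_rate _ _ (77 / 100)); lra.
Qed.

Lemma num_three : [&& 4 / 5 <= 27 / 25 :> R, 1 / 3 <= 31 / 50 :> R, 1 / 3 <= 9 / 10 :> R,
  9 / 10 <= 31 / 25 :> R, 9 / 10 <= 1 :> R & 31 / 50 <= 9 / 10 :> R].
Proof. by repeat (apply/andP; split); lra. Qed.

Lemma num_five : [&& 4 / 5 <= 37 / 36 :> R, 4 / 5 <= 15 / 16 :> R, 15 / 16 <= 37 / 36 :> R,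
  1 / 3 <= 12 / 25 :> R, 1 / 3 <= 87 / 100 :> R, 87 / 100 <= 37 / 25 :> R, 87 / 100 <= 31 / 25 :> R &
  43 / 50 <= 87 / 100 :> R].
Proof. by repeat (apply/andP; split); lra. Qed.

Lemma num_four : [&& 1 / 3 <= 19 / 20 :> R, 1 / 3 <= 31 / 50 :> R, 19 / 20 <= 139 / 100 :> R,
  19 / 20 <= 1 :> R & 77 / 100 <= 19 / 20 :> R].
Proof. by repeat (apply/andP; split); lra. Qed.

End Certificates.

Section BlockCases.
Variables (R : realFieldType) (x : R).
Hypotheses (x_gt0 : 0 < x) (x_sq : x ^+ 2 = 1 - x).
Variable s : nat.
Hypotheses (s_gt0 : (0 < s)%N) (s_large : 1 <= eps R * (1 + eps R) ^+ s).
Variables m G : nat.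
Notation V := 'I_m.+1.
Notation W := {ffun 'I_m.+1 -> 'I_G.+2}.
Implicit Types (w : W) (p v b i j : V) (Om : pred W) (B E : {set V}).
Local Notation eps := (eps R).
Local Notation weight := (weight x).
Local Notation d := (16 * s)%N.

(** [B] is the set of the last [d] positions with letters at least [r], and [c] its
    left end; or there are at most [d] such positions, and [c] is 0. *)
Definition top_block (r : nat) (c : 'I_m.+2) B w :=
  (B == [set v : V | (r <= w v)%N && (c <= v)%N]%SET) &&
  ((c == 0%N :> nat) || (#|B| == d)).

Lemma top_blockP r c B w : top_block r c B w ->
  [/\ forall b, b \in B -> (r <= w b)%N /\ (c <= b)%N,
      forall v, v \notin B -> (c <= v)%N -> (w v <= r.-1)%N
    & (0 < c)%N -> #|B| = d].
Proof.
case/andP => /eqP -> h; split => [b|v|c0].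
- by rewrite inE => /andP[].
- by rewrite inE; apply: not_top.
- by case/orP: h => /eqP // c0'; rewrite c0' in c0.
Qed.

Lemma cover_block (r : nat) Om (K : R) : 0 <= K ->
  (forall c B, (#|B| <= d)%N ->
     \sum_(w | Om w && top_block r c B w) weight w <= K) ->
  \sum_(w | Om w) weight w <=
    eps^-1 * (1 + eps) ^+ m.+1 * ((eps ^+ d)^-1 * (1 + eps) ^+ m.+1 * K).
Proof.
move=> K0 hK.
have e0 : 0 <= 1 + eps by rewrite addr_ge0 // ltW // eps_gt0.
have K1 : 0 <= (eps ^+ d)^-1 * (1 + eps) ^+ m.+1 * K.
  exact: set_factor_ge0.
apply: (cover_points (I := 'I_m.+2)
  (B := fun c w => (#|[set v in [set v : V | (r <= w v)%N] | (c <= v)%N]%SET| <= d)%N &&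
     ((c == 0%N :> nat) || (#|[set v in [set v : V | (r <= w v)%N] | (c <= v)%N]%SET| == d)))) => //.
- by move=> w; apply: weight_ge0.
- by rewrite card_ord.
- move=> w _; have [c [h1 h2]] := last_block [set v : V | (r <= w v)%N]%SET d.
  exists c; rewrite h1 /=; apply/orP; case: h2 => ->; [left|right]; exact: eqxx.
move=> c.
apply: (cover_small_sets (B := fun B w => top_block r c B w)) => //.
- by move=> w; apply: weight_ge0.
- exact: card_ord.
- move=> w /and3P[_ hd hc]; exists [set v : V | (r <= w v)%N && (c <= v)%N]%SET.
    by move: hd; congr (_ <= _)%N; apply: eq_card => v; rewrite !inE.
  rewrite /top_block eqxx /=; move: hc; congr (_ || _).
  by congr (_ == _); apply: eq_card => v; rewrite !inE.
move=> B Bd; apply: le_trans (hK c B Bd).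
rewrite big_mkcond [leRHS]big_mkcond /=; apply: ler_sum => w _.
case: ifP => [/andP[/andP[-> _] ->]//|_]; case: ifP => // _; exact: weight_ge0.
Qed.

(** The words that end in 3 with no larger letter, and those with largest letter
    4 that have at most [d] letters 4; the positions of these are exceptional.
    Let [c] be the left end of the block of the last [d] letters at least 3.  Past
    [c] all other letters are 1 or 2.  If [c] is at most half of the length, these
    positions are so many that one reflection suffices; otherwise the positions
    before [c] are so many that the container bound does. *)
Lemma case_three Om :
  (forall w, Om w -> [/\ zero_headed w, forall v, (w v <= 4)%N,
     (#|[set v : V | w v == 4%N :> nat]%SET| <= d)%N,
     exists p, forall v, (3 <= w v + w (p - v)%R)%N
   & forall i j b, (i + j = b)%N -> (3 <= w b)%N -> (3 <= w i + w j)%N]) ->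
  \sum_(w | Om w) weight w <=
    (eps ^+ d)^-1 * (1 + eps) ^+ m.+1 * (eps^-1 * (1 + eps) ^+ m.+1 *
    (eps^-1 * (1 + eps) ^+ m.+1 * ((eps ^+ d)^-1 * (1 + eps) ^+ m.+1 *
      (8 ^+ (2 * (1 + d + d) + 2) * ((1 + eps) * (1 + eps) * (19 / 20)) ^+ m.+1)))).
Proof.
move=> OmP.
have e1 : 1 <= 1 + eps by rewrite lerDl ltW // eps_gt0.
have ee1 : 1 <= (1 + eps) * (1 + eps) by rewrite -[leLHS]mulr1 ler_pM.
have e0 : 0 <= 1 + eps by rewrite addr_ge0 // ltW // eps_gt0.
have ep : 0 <= eps by rewrite ltW // eps_gt0.
have /and5P[n1 n2 n3 n4 /andP[n5 n6]] := num_three R.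
set K := 8 ^+ _ * _ ^+ _.
have K0 : 0 <= K.
  by rewrite /K; apply: mulr_ge0; apply: exprn_ge0 => //; apply: mulr_ge0 => //; apply: mulr_ge0.
apply: (cover_small_sets (B := fun X w => [set v : V | w v == 4%N :> nat]%SET == X)).
- by move=> w; apply: weight_ge0.
- by do 2!apply: point_factor_ge0; apply: set_factor_ge0.
- exact: card_ord.
- by move=> w /OmP[_ _ h _ _]; exists [set v : V | w v == 4%N :> nat]%SET.
move=> X Xd.
apply: (cover_points (I := V) (B := fun p w => [forall v, (3 <= w v + w (p - v)%R)%N])).
- by move=> w; apply: weight_ge0.
- by apply: point_factor_ge0; apply: set_factor_ge0.
- by rewrite card_ord ltnW.
- by move=> w /andP[/OmP[_ _ _ [p h] _] _]; exists p; apply/forallP.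
move=> p; apply: (@cover_block 3) => // c B Bd.
pose E := (0 |: X :|: B)%SET.
have En : (#|E| <= 1 + d + d)%N.
  apply: leq_trans (leq_card_setU _ _) (leq_add _ Bd).
  by apply: leq_trans (leq_card_setU _ _) _; rewrite cards1 leq_add2l.
pose Om' w := [&& Om w && ([set v : V | w v == 4%N :> nat]%SET == X),
  [forall v, (3 <= w v + w (p - v)%R)%N] & top_block 3 c B w].
rewrite (eq_bigl Om') => [|w]; last by rewrite /Om' -!andbA.
have OmP' w : Om' w -> [/\ zero_headed w, forall v, v \notin E -> (w v <= 3)%N,
    forall v, (3 <= w v + w (p - v)%R)%N,
    forall i j b, (i + j = b)%N -> (3 <= w b)%N -> (3 <= w i + w j)%N & top_block 3 c B w].
  move=> /and3P[/andP[/OmP[zw w4 _ _ low] /eqP defX] /forallP pw tb]; split => // v.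
  rewrite !inE -defX inE !negb_or => /andP[/andP[_ h] _].
  by rewrite -ltnS ltn_neqAle h w4.
have cm : (c <= m.+1)%N by rewrite -ltnS.
have [c_small|c_large] := leqP (2 * c) m.+1.
  pose h v := if (v < c)%N then 3%N else 2%N.
  apply: (@le_trans _ _ (4 ^+ (2 * (1 + d + d) + 2) *
      \prod_(v : V) (if (v < c)%N then 27 / 25 else 4 / 5))).
    apply: (@pair_case _ _ x_gt0 x_sq m G p E _ _
       (fun v a a' => pair_ok (h v) (h (p - v)%R) 3 a a')) => //.
    - move=> w v Ow vE pvE.
      have [[_ w_pos] w3 pw _ /top_blockP[_ wh _]] := OmP' w Ow.
      have bd u : u \notin E -> (0 < w u)%N && (w u <= h u)%N.
        move=> uE; rewrite w_pos /=; last first.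
          by apply: contra uE => /eqP ->; rewrite !inE eqxx.
        rewrite /h; case: ltnP => cu; first exact: w3.
        by apply: wh cu; apply: contra uE; rewrite !inE => ->; rewrite orbT.
      by rewrite /pair_ok /between pw !bd.
    - move=> v; rewrite /h; case: (v < c)%N; case: ((p - v)%R < c)%N.
      + exact: pairs333.
      + exact: pairs323.
      + exact: pairs233.
      + exact: pairs223.
    - by move=> v; case: ifP.
  rewrite prod_levels // /K; apply: ler_pM; rewrite ?exprn_ge0 ?mulr_ge0 ?exprn_ge0 //.
    by apply: lerXn2r; rewrite ?nnegrE // ler_nat.
  apply: (@le_trans _ _ ((19 / 20) ^+ m.+1)).
    exact: rates_three_pair.
  by apply: lerXn2r; rewrite ?nnegrE ?mulr_ge0 // ler_peMl.
(* Any word of the set shows the properties of [B]; an empty set weighs 0. *)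
case: (pickP Om') => [w0 /OmP'[_ _ _ _ /top_blockP[Bc _ Bd']] | none]; last first.
  by rewrite big_pred0.
have {}Bd' : #|B| = d by apply: Bd'; move: c_large; case: (nat_of_ord c); rewrite ?muln0.
apply: (@le_trans _ _ (((1 + eps) * (1 + eps)) ^+ m.+1 *
   (8 ^+ (1 + d + d) * ((9 / 10) ^+ c * 1 ^+ (m.+1 - c))))).
  apply: (@lower_container _ _ x_gt0 x_sq s s_gt0 s_large m G c B E 3 3 _ _ (31 / 25) (31 / 50) 1 (9 / 10)) => //.
  - by move=> b /Bc[].
  - move=> w i j b /OmP'[_ _ _ low /top_blockP[h _ _]] bB ijb.
    by apply: low ijb _; case: (h b bB).
  - move=> w v Ow vE; have [[_ w_pos] w3 _ _ _] := OmP' w Ow.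
    rewrite /between w3 // andbT w_pos //.
    by apply: contra vE => /eqP ->; rewrite !inE eqxx.
  - move=> w v Ow vE cv; have [[_ w_pos] _ _ _ /top_blockP[_ h _]] := OmP' w Ow.
    rewrite /between w_pos /=; last by apply: contra vE => /eqP ->; rewrite !inE eqxx.
    by apply: h cv; apply: contra vE; rewrite !inE => ->; rewrite orbT.
  - exact: certificate_three.
  - exact: letters13.
  - exact: letters23.
  - exact: le_trans (letters23 x_gt0 x_sq _) n6.
  - exact: letters12.
rewrite /K exprMn mulrCA; apply: ler_pM; rewrite ?exprn_ge0 ?mulr_ge0 ?exprn_ge0 //.
  by apply: ler_weXn2l (le_double2 _); rewrite (ler1n R 8).
rewrite -exprMn [leRHS]exprMn ler_wpM2l ?exprn_ge0 ?mulr_ge0 //.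
exact: rates_three_container.
Qed.

(** The same dichotomy for the letters at least 4, now at two thirds of the
    length.  The reflection is the one through the last 5, so the letters to the
    right of its centre are at most 4. *)
Lemma case_five Om :
  (forall w, Om w -> [/\ zero_headed w, forall v, (w v <= 5)%N,
     exists p, forall v, if (v <= p)%N then (5 <= w v + w (p - v)%R)%N
        else (w v <= 4)%N && (4 <= w v + w (p - v)%R)%N
   & forall i j b, (i + j = b)%N -> (4 <= w b)%N -> (4 <= w i + w j)%N]) ->
  \sum_(w | Om w) weight w <=
    eps^-1 * (1 + eps) ^+ m.+1 *
    (eps^-1 * (1 + eps) ^+ m.+1 * ((eps ^+ d)^-1 * (1 + eps) ^+ m.+1 *
      (8 ^+ (2 * (1 + d) + 2) * ((1 + eps) * (1 + eps) * (310 / 311)) ^+ m.+1))).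
Proof.
move=> OmP.
have e1 : 1 <= 1 + eps by rewrite lerDl ltW // eps_gt0.
have ee1 : 1 <= (1 + eps) * (1 + eps) by rewrite -[leLHS]mulr1 ler_pM.
have e0 : 0 <= 1 + eps by rewrite addr_ge0 // ltW // eps_gt0.
have ep : 0 <= eps by rewrite ltW // eps_gt0.
have /and5P[n1 n2 n3 n4 /and4P[n5 n6 n7 n8]] := num_five R.
have q0 : 0 <= 15 / 16 :> R by apply: le_trans n2; rewrite divr_ge0.
set K := 8 ^+ _ * _ ^+ _.
have r311 : 0 <= 310 / 311 :> R by apply: divr_ge0; apply: ler0n.
have ee0 : 0 <= (1 + eps) * (1 + eps) by apply: mulr_ge0.
have K0 : 0 <= K.
  apply: mulr_ge0; first by apply: exprn_ge0; apply: ler0n.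
  by apply: exprn_ge0; exact: mulr_ge0 ee0 r311.
pose five p w v : bool := if (v <= p)%N then (5 <= w v + w (p - v)%R)%N
        else (w v <= 4)%N && (4 <= w v + w (p - v)%R)%N.
apply: (cover_points (I := V) (B := fun p w => [forall v, five p w v])).
- by move=> w; apply: weight_ge0.
- by apply: point_factor_ge0; apply: set_factor_ge0.
- by rewrite card_ord ltnW.
- by move=> w /OmP[_ _ [p h] _]; exists p; apply/forallP.
move=> p; apply: (@cover_block 4) => // c B Bd.
pose E := (0 |: B)%SET.
have En : (#|E| <= 1 + d)%N.
  by apply: leq_trans (leq_card_setU _ _) _; rewrite cards1 leq_add2l.
pose Om' w := [&& Om w, [forall v, five p w v] & top_block 4 c B w].
rewrite (eq_bigl Om') => [|w]; last by rewrite /Om' -!andbA.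
have OmP' w : Om' w -> [/\ zero_headed w, forall v, (w v <= 5)%N,
    forall v, five p w v,
    forall i j b, (i + j = b)%N -> (4 <= w b)%N -> (4 <= w i + w j)%N & top_block 4 c B w].
  by move=> /and3P[/OmP[zw w5 _ low] /forallP pw tb]; split.
have pos w v : Om' w -> v \notin E -> (0 < w v)%N.
  move=> /OmP'[[_ w_pos] _ _ _ _] vE; apply: w_pos.
  by apply: contra vE => /eqP ->; rewrite !inE eqxx.
have low3 w v : Om' w -> v \notin E -> (c <= v)%N -> (w v <= 3)%N.
  move=> /OmP'[_ _ _ _ /top_blockP[_ h _]] vE; apply: h.
  by apply: contra vE; rewrite !inE => ->; rewrite orbT.
have cm : (c <= m.+1)%N by rewrite -ltnS.
have [c_small|c_large] := leqP (3 * c) (2 * m.+1).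
  pose h v := if (v < c)%N then 4%N else 3%N.
  apply: (@le_trans _ _ (4 ^+ (2 * (1 + d) + 2) *
      \prod_(v : V) (if (v < c)%N then 37 / 36 else 15 / 16))).
    apply: (@pair_case _ _ x_gt0 x_sq m G p E _ _
       (fun v a a' => if (v <= p)%N then pair_ok 5 5 5 a a'
                      else pair_ok (h v) (h (p - v)%R) 4 a a')) => //.
    - move=> w v Ow vE pvE.
      have [_ w5 pw _ _] := OmP' w Ow.
      move: (pw v) (pw (p - v)); rewrite /five mate_leq subKr /pair_ok /between !pos //.
      case: ifP => _; first by rewrite !w5 => ->.
      move=> /andP[a4 ->] /andP[b4 _]; rewrite andbT /=.
      have bd u : u \notin E -> (w u <= 4)%N -> (w u <= h u)%N.
        by move=> uE u4; rewrite /h; case: ltnP => // cu; apply: low3.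
      by rewrite !bd.
    - move=> v; case: (v <= p)%N.
        apply: le_trans (pairs555 x_gt0 x_sq _) _; apply: ler_pM => //; by case: ifP.
      rewrite /h; case: (v < c)%N; case: ((p - v)%R < c)%N.
      + exact: pairs444.
      + exact: pairs434.
      + exact: pairs344.
      + exact: pairs334.
    - by move=> v; case: ifP.
  rewrite prod_levels // /K; apply: ler_pM.
  - exact: exprn_ge0.
  - by apply: mulr_ge0; apply: exprn_ge0 => //; apply: le_trans n3.
  - by apply: lerXn2r; rewrite ?nnegrE // ler_nat.
  apply: (@le_trans _ _ ((310 / 311) ^+ m.+1)).
    exact: rates_five_pair.
  by apply: lerXn2r; rewrite ?nnegrE ?(mulr_ge0 ee0 r311) // ler_peMl.
(* Any word of the set shows the properties of [B]; an empty set weighs 0. *)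
case: (pickP Om') => [w0 /OmP'[_ _ _ _ /top_blockP[Bc _ Bd']] | none]; last first.
  by rewrite big_pred0.
have {}Bd' : #|B| = d by apply: Bd'; move: c_large; case: (nat_of_ord c); rewrite ?muln0.
apply: (@le_trans _ _ (((1 + eps) * (1 + eps)) ^+ m.+1 *
   (8 ^+ (1 + d) * ((87 / 100) ^+ c * (31 / 25) ^+ (m.+1 - c))))).
  apply: (@lower_container _ _ x_gt0 x_sq s s_gt0 s_large m G c B E 4 5 _ _
    (37 / 25) (12 / 25) (31 / 25) (87 / 100)) => //.
  - by move=> b /Bc[].
  - move=> w i j b /OmP'[_ _ _ low /top_blockP[h _ _]] bB ijb.
    by apply: low ijb _; case: (h b bB).
  - by move=> w v Ow vE; have [_ w5 _ _ _] := OmP' w Ow; rewrite /between w5 pos.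
  - by move=> w v Ow vE cv; rewrite /between pos // low3.
  - exact: certificate_five.
  - exact: letters15.
  - exact: letters35.
  - exact: le_trans (letters25 x_gt0 x_sq _) n8.
  - exact: letters13.
have r0 : 0 <= 87 / 100 :> R by rewrite divr_ge0.
have r1 : 0 <= 31 / 25 :> R by rewrite divr_ge0.
have mk k l : 0 <= (87 / 100) ^+ k * (31 / 25) ^+ l :> R by rewrite mulr_ge0 // exprn_ge0.
rewrite /K exprMn mulrCA; apply: ler_pM; rewrite ?exprn_ge0 ?mulr_ge0 ?exprn_ge0 //.
  by apply: ler_weXn2l (le_double2 _); rewrite (ler1n R 8).
rewrite -exprMn [leRHS]exprMn ler_wpM2l ?exprn_ge0 ?mulr_ge0 //.
exact: rates_five_container.
Qed.

(** More than [d] letters 4 and none larger.  All reflections through the last [d]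
    letters 4 are used on both sides of their centres, so every position has full
    degree.  A neighbour of a 1 carries a 3 or a 4 if it lies before the block; if
    it lies past the left end of the block it carries a 2 or a 3, because the
    remaining letters there are at most 3.  Both sums are at most [31 / 50]. *)
Lemma case_four Om :
  (forall w, Om w -> [/\ zero_headed w, forall v, (w v <= 4)%N,
     (d < #|[set v : V | w v == 4%N :> nat]%SET|)%N
   & forall v b, w b = 4%N :> nat ->
       (if (v <= b)%N then 4 <= w v + w (b - v)%R else 3 <= w v + w (b - v)%R)%N]) ->
  \sum_(w | Om w) weight w <=
    eps^-1 * (1 + eps) ^+ m.+1 * ((eps ^+ d)^-1 * (1 + eps) ^+ m.+1 *
      (8 ^+ (1 + d) * ((1 + eps) * (1 + eps) * (19 / 20)) ^+ m.+1)).
Proof.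
move=> OmP.
have e1 : 1 <= 1 + eps by rewrite lerDl ltW // eps_gt0.
have ep : 0 <= eps by rewrite ltW // eps_gt0.
have e0 : 0 <= 1 + eps by rewrite addr_ge0.
have /and5P[n1 n2 n3 n4 n5] := num_four R.
have r0 : 0 < 19 / 20 :> R by rewrite divr_gt0.
have f0 : 0 <= 31 / 50 :> R by rewrite divr_ge0.
set K := 8 ^+ _ * _ ^+ _.
have K0 : 0 <= K.
  rewrite /K; apply: mulr_ge0; apply: exprn_ge0 => //; apply: mulr_ge0; last exact: ltW.
  by apply: mulr_ge0.
apply: (@cover_block 4) => // c B Bd.
pose E := (0 |: B)%SET.
have En : (#|E| <= 1 + d)%N.
  by apply: leq_trans (leq_card_setU _ _) _; rewrite cards1 leq_add2l.
pose Om' w := Om w && top_block 4 c B w.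
rewrite -/(\sum_(w | Om' w) weight w).
have OmP' w : Om' w -> [/\ zero_headed w, forall v, (w v <= 4)%N,
    forall v, v \notin E -> (c <= v)%N -> (w v <= 3)%N,
    forall v b, b \in B -> (if (v <= b)%N then 4 <= w v + w (b - v)%R else 3 <= w v + w (b - v)%R)%N
   & #|B| = d /\ forall b, b \in B -> (c <= b)%N].
  move=> /andP[/OmP[zw w4 d4 pw] tb].
  have [Bc Bn Bd'] := top_blockP tb; split => //.
  - by move=> v vE; apply: Bn; apply: contra vE; rewrite !inE => ->; rewrite orbT.
  - move=> v b /Bc[wb _]; apply: pw; apply/eqP; rewrite eqn_leq w4; exact: wb.
  split; last by move=> b /Bc[].
  apply: Bd'; rewrite lt0n; apply/negP => /eqP c0.
  move: Bd; rewrite leqNgt => /negP; apply; apply: leq_trans d4 _.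
  apply: subset_leq_card; apply/fintype.subsetP => v; rewrite inE => /eqP wv.
  by move: tb; rewrite /top_block => /andP[/eqP -> _]; rewrite inE wv c0.
(* Any word of the set shows the properties of [B]; an empty set weighs 0. *)
case: (pickP Om') => [w0 /OmP'[_ _ _ _ [Bd' Bc]] | none]; last first.
  by rewrite big_pred0.
pose e (v j : V) := (v + j)%R \in B.
have nbrsE v : nbrs e v = [set b - v | b in B]%SET.
  apply/setP => j; rewrite inE /e; apply/idP/imsetP => [h|[b bB ->]]; last first.
    by rewrite addrC subrK.
  by exists (v + j) => //; rewrite addrC addKr.
have cardN v : #|nbrs e v| = d by rewrite nbrsE card_imset //; apply: mate_inj.
pose Q v (a : 'I_G.+2) := (v \in E) || between 1 4 a.
pose QF v (a : 'I_G.+2) := (v \in E) || (if (c <= v)%N then between 2 3 a else between 3 4 a).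
have sall (P : pred 'I_G.+2) (k : R) : 1 / 3 <= k -> \sum_(a | P a) x ^+ a <= 8 ^+ true * k.
  move=> K3; apply: (@le_trans _ _ (8 / 3)).
    apply: le_trans (sum_letters x_gt0 x_sq G.+2); rewrite big_mkcond /=.
    by apply: ler_sum => a _; case: ifP => // _; rewrite exprn_ge0 // ltW.
  by rewrite expr1 -[8 / 3]mulr1 mulrAC -mulrA ler_wpM2l // mulrC.
have n6 : 1 / 3 <= 139 / 100 :> R by apply: le_trans n3.
rewrite /weight.
apply: (@le_trans _ _ (((1 + eps) * (1 + eps)) ^+ #|V| *
   (8 ^+ #|E| * ((19 / 20) ^+ #|[set: V]%SET| * 1 ^+ (#|V| - #|[set: V]%SET|))))).
  apply: (@container_sum _ V _ e (fun a : 'I_G.+2 => x ^+ a) (inord 1)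
    Om' [set: V]%SET E s _ _ Q QF (139 / 100) (31 / 50)) => //; rewrite ?eps_gt0 //.
  - by move=> a; rewrite exprn_ge0 // ltW.
  - by move=> i j; rewrite /e addrC.
  - by move=> v; rewrite cardN.
  - by move=> v _; rewrite cardN.
  - move=> w v /OmP'[[_ w_pos] w4 _ _ _]; rewrite /Q; case: (boolP (v \in E)) => //= vE.
    rewrite /between w4 andbT; apply: w_pos.
    by apply: contra vE => /eqP ->; rewrite !inE eqxx.
  - move=> w i j Ow eij wi.
    have [[_ w_pos] w4 w3 pw _] := OmP' w Ow.
    rewrite /QF; case: (boolP (j \in E)) => //= jE.
    have wi1 : w i = 1%N :> nat by rewrite wi inordK.
    have jmate : i + j - i = j by rewrite addrC addKr.
    have imate : i + j - j = i by rewrite addrK.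
    have := pw i _ eij; rewrite jmate wi1 add1n /between.
    case: (leqP c j) => cj; first by rewrite (w3 j jE cj) andbT; case: ifP => // _ /ltnW.
    rewrite w4 andbT ifT // -mate_leq jmate.
    have : (c <= (i + j)%R)%N.
      by have [_ _ _ _ [_ h]] := OmP' w Ow; apply: h.
    by move=> h; apply: ltnW; apply: leq_trans cj h.
  - exact: certificate_four.
  - move=> v; rewrite /QF; case: (boolP (v \in E)) => [vE|vE]; first exact: sall.
    by rewrite expr0 mul1r; case: (c <= v)%N; [exact: letters23 | exact: letters34].
  - move=> v _; rewrite /Q; case: (boolP (v \in E)) => [vE|vE]; first exact: sall.
    by rewrite expr0 mul1r letters14.
  - move=> v _; rewrite /Q; case: (boolP (v \in E)) => [vE|vE]; first exact: sall.
    rewrite expr0 mul1r /=; apply: le_trans n5; apply: le_trans (letters24 x_gt0 x_sq G.+2).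
    rewrite big_mkcond [leRHS]big_mkcond /=; apply: ler_sum => a _.
    case: ifP => [/andP[h a1]|_]; last by case: ifP => // _; rewrite exprn_ge0 // ltW.
    rewrite ifT //; move: h; rewrite /between => /andP[h ->]; rewrite andbT ltn_neqAle h andbT.
    by apply: contra a1 => /eqP h1; apply/eqP/val_inj; rewrite /= inordK.
  - by move=> v; rewrite inE.
rewrite cardsT card_ord subnn expr0 mulr1 /K mulrCA.
apply: ler_pM; rewrite ?exprn_ge0 ?mulr_ge0 ?exprn_ge0 ?(ltW r0) //.
- exact: mulr_ge0.
- by apply: ler_weXn2l En; rewrite (ler1n R 8).
by rewrite -exprMn.
Qed.

End BlockCases.

(** * The weight of the bad words *)

Section BadWords.
Variables (m G : nat).
Notation V := 'I_m.+1.
Implicit Types (w : {ffun 'I_m.+1 -> 'I_G.+2}) (u v p b i j k : 'I_m.+1).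

Definition kunz_fun w :=
  [/\ zero_headed w,
      forall i j k, (i + j = k)%N -> (w k <= w i + w j)%N
    & forall i j k, (i + j = k + m.+1)%N -> (w k <= w i + w j + 1)%N].

Lemma kunz_below w p u : kunz_fun w -> (u <= p)%N -> (w p <= w u + w (p - u)%R)%N.
Proof. by case=> _ h _ up; apply: h; apply: mate_le. Qed.

Lemma kunz_above w p u : kunz_fun w -> (p < u)%N -> (w p <= w u + w (p - u)%R + 1)%N.
Proof. by case=> _ _ h pu; apply: h; apply: mate_gt. Qed.

Lemma kunz_all w p u : kunz_fun w -> (w p <= w u + w (p - u)%R + 1)%N.
Proof.
move=> kw; case: (leqP u p) => h; last exact: kunz_above.
by apply: leq_trans (kunz_below kw h) _; rewrite leq_addr.
Qed.

Lemma last_position w q v0 : (forall v, (w v <= q.+1)%N) -> (q < w v0)%N ->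
  exists2 p, w p = q.+1 :> nat & forall u, (p < u)%N -> (w u <= q)%N.
Proof.
move=> wq h0.
case: (@arg_maxnP _ v0 (fun v => (q < w v)%N) (fun v => v : nat) h0) => p qp pmax.
exists p => [|u pu]; first by apply/eqP; rewrite eqn_leq wq.
by rewrite leqNgt; apply/negP => /pmax /=; rewrite leqNgt pu.
Qed.

(** The words of depth at least 4, and the stressed words. *)
Definition bad_word w :=
  (exists v, (4 <= w v)%N) \/ (forall v, (w v <= 3)%N) /\ w ord_max = 3%N :> nat.

End BadWords.

Lemma leq_of_succ a b c : (a.+1 <= b + c + 1 -> a <= b + c)%N.
Proof. by rewrite addn1. Qed.

Section Factors.
Variable A : comNzRingType.
Implicit Types a c D E q : A.

Lemma factors1 a c E q : a * E * (c * q) = (a * c) * E ^+ 1 * q.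
Proof. ring. Qed.

Lemma factors4 a c D E q : a * E * (D * E * (c * (E * E * q))) = (a * D * c) * E ^+ 4 * q.
Proof. ring. Qed.

Lemma factors5 a c D E q :
  a * E * (a * E * (D * E * (c * (E * E * q)))) = (a * a * D * c) * E ^+ 5 * q.
Proof. ring. Qed.

Lemma factors6 a c D E q :
  D * E * (a * E * (a * E * (D * E * (c * (E * E * q))))) = (D * a * a * D * c) * E ^+ 6 * q.
Proof. ring. Qed.

Lemma exprMM E q N : (E * E * q) ^+ N = E ^+ N * E ^+ N * q ^+ N.
Proof. by rewrite !exprMn. Qed.

End Factors.

Section BadSum.
Variables (R : realType) (x : R).
Hypotheses (x_gt0 : 0 < x) (x_sq : x ^+ 2 = 1 - x).
Local Notation eps := (eps R).

Definition decay : R := 999 / 1000.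

Lemma decay_ge0 : 0 <= decay. Proof. by apply: divr_ge0; apply: ler0n. Qed.

Lemma decay_lt1 : decay < 1. Proof. rewrite /decay; lra. Qed.

(** Fingerprints of relative size [1 / s] are few: at most [(1 + eps) ^ (2 n)]. *)
Lemma exists_fingerprint_size : exists2 s, (0 < s)%N & 1 <= eps * (1 + eps) ^+ s.
Proof.
have e0 := eps_gt0 R.
exists (Num.bound (eps^-1 * eps^-1)).+1 => //.
set s := Num.bound _.
have hs : eps^-1 * eps^-1 <= s.+2%:R.
  have /archi_boundP/ltW h : 0 <= eps^-1 * eps^-1 by rewrite mulr_ge0 // invr_ge0 ltW.
  by apply: le_trans h _; rewrite ler_nat; apply: leqW; apply: leqnSn.
have := le_trans hs (le_exp_eps R s.+1).
by rewrite ler_pM2l ?invr_gt0 // => h; rewrite -ler_pdivrMl // mulr1.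
Qed.

(** At most six choices, each at the cost of one factor [1 + eps], are made in a
    case, and [310 / 311] is the worst rate of a case. *)
Lemma rate_bound : (1 + eps) ^+ 6 * (310 / 311) <= decay.
Proof.
have six (t : R) : 0 <= t -> t <= 1 / 100 -> (1 + t) ^+ 6 <= 1 + 7 * t.
  move=> t0 t1; rewrite (exprM _ 3 2).
  have c3 : (1 + t) ^+ 3 <= 1 + 25 / 8 * t by nra.
  apply: (@le_trans _ _ ((1 + 25 / 8 * t) ^+ 2)); last by nra.
  by apply: lerXn2r; rewrite ?nnegrE ?exprn_ge0 //; lra.
have h : (1 + eps) ^+ 6 <= 1 + 7 * eps.
  by apply: six; rewrite /eps; lra.
apply: (@le_trans _ _ ((1 + 7 * eps) * (310 / 311))).
  by apply: ler_wpM2r h; apply: divr_ge0; apply: ler0n.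
rewrite /eps /decay; lra.
Qed.

Lemma absorb (N k : nat) (K r : R) : 0 <= K -> (k <= 6)%N -> 0 <= r -> r <= 310 / 311 ->
  K * ((1 + eps) ^+ N) ^+ k * r ^+ N <= K * decay ^+ N.
Proof.
move=> K0 k6 r0 r1.
have e1 : 1 <= 1 + eps by rewrite lerDl ltW // eps_gt0.
have e0 : 0 <= 1 + eps by apply: le_trans e1.
rewrite -mulrA; apply: ler_wpM2l => //; rewrite exprAC -exprMn.
have h : (1 + eps) ^+ k * r <= decay.
  apply: le_trans rate_bound; apply: ler_pM => //; first exact: exprn_ge0.
  exact: ler_weXn2l.
apply: lerXn2r h; rewrite nnegrE; last exact: decay_ge0.
exact: mulr_ge0 (exprn_ge0 _ e0) r0.
Qed.

(** The cases are sorted by the largest letter [q].  For [q = 5, 6] the centre of the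
    reflection is the last occurrence of [q]: past it the letters are at most
    [q - 1], which compensates for the 1 that is lost in the Kunz inequalities of
    the second family.  If [q] is 3, the centre is the end of the word, and all
    positions are to the left of it. *)
Theorem bad_words_bound : exists2 K : R, 0 <= K &
  forall m G (Om : pred {ffun 'I_m.+1 -> 'I_G.+2}),
    (forall w, Om w -> kunz_fun w /\ bad_word w) ->
    \sum_(w | Om w) weight x w <= K * decay ^+ m.+1.
Proof.
have [s s0 s1] := exists_fingerprint_size.
have e1 : 1 <= 1 + eps by rewrite lerDl ltW // eps_gt0.
have e0 : 0 <= 1 + eps by apply: le_trans e1.
have ei0 : 0 <= eps^-1 by rewrite invr_ge0 ltW // eps_gt0.
pose d := (16 * s)%N.
pose D := (eps ^+ d)^-1.
have D0 : 0 <= D by rewrite invr_ge0 exprn_ge0 // ltW // eps_gt0.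
pose K12 : R := eps^-1 * 4 ^+ 4.
pose K3 : R := D * eps^-1 * eps^-1 * D * 8 ^+ (2 * (1 + d + d) + 2).
pose K5 : R := eps^-1 * eps^-1 * D * 8 ^+ (2 * (1 + d) + 2).
pose K4 : R := eps^-1 * D * 8 ^+ (1 + d).
have K120 : 0 <= K12 by apply: mulr_ge0 => //; apply: exprn_ge0.
have K30 : 0 <= K3 by do !apply: mulr_ge0 => //; apply: exprn_ge0; apply: ler0n.
have K50 : 0 <= K5 by do !apply: mulr_ge0 => //; apply: exprn_ge0; apply: ler0n.
have K40 : 0 <= K4 by do !apply: mulr_ge0 => //; apply: exprn_ge0; apply: ler0n.
exists (K12 + (K12 + (K5 + (K4 + K3)))).
  by do !apply: addr_ge0.
move=> m G Om OmP.
pose has r (w : {ffun 'I_m.+1 -> 'I_G.+2}) := [exists v, (r <= w v)%N].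
have hasN r (w : {ffun 'I_m.+1 -> 'I_G.+2}) : ~~ has r.+1 w -> forall v, (w v <= r)%N.
  by move=> /existsPn h v; rewrite leqNgt; apply: h.
have [r1 r2 r3] : [/\ 99 / 100 <= 310 / 311 :> R, 15 / 16 <= 310 / 311 :> R &
   19 / 20 <= 310 / 311 :> R] by split; lra.
have q0 (a b : nat) : 0 <= a%:R / b%:R :> R by apply: divr_ge0; apply: ler0n.
rewrite (bigID (has 7%N)) /= mulrDl; apply: lerD.
  apply: le_trans (@case_large _ _ x_gt0 x_sq m G _ _) _.
    move=> w /andP[/OmP[kw _] /existsP[p wp]]; split; first by case: kw.
    exists p => u; apply: leq_of_succ; apply: leq_trans wp _; exact: kunz_all.
  rewrite factors1; apply: absorb => //; exact: q0.
rewrite (bigID (has 6%N)) /= mulrDl; apply: lerD.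
  apply: le_trans (@case_six _ _ x_gt0 x_sq m G _ _) _.
    move=> w /andP[/andP[/OmP[kw _] /hasN w6] /existsP[v0 wv0]]; split; first by case: kw.
    have [p wp pl] := last_position w6 wv0; exists p => u.
    case: (leqP u p) => h; first by rewrite w6 -wp kunz_below.
    by rewrite pl //=; apply: leq_of_succ; rewrite -wp; apply: kunz_all.
  rewrite factors1; apply: absorb => //; exact: q0.
rewrite (bigID (has 5%N)) /= mulrDl; apply: lerD.
  apply: le_trans (@case_five _ _ x_gt0 x_sq s s0 s1 m G _ _) _.
    move=> w /andP[/andP[/andP[/OmP[kw _] _] /hasN w5] /existsP[v0 wv0]].
    have [zw kw1 _] := kw; split => //; last first.
      by move=> i j b ijb h; apply: leq_trans h (kw1 _ _ _ ijb).
    have [p wp pl] := last_position w5 wv0; exists p => u.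
    case: (leqP u p) => h; first by rewrite -wp kunz_below.
    by rewrite pl //=; apply: leq_of_succ; rewrite -wp; apply: kunz_all.
  rewrite exprMM factors5; apply: absorb => //; exact: q0.
pose many (w : {ffun 'I_m.+1 -> 'I_G.+2}) :=
  has 4%N w && (d < #|[set v : 'I_m.+1 | w v == 4%N :> nat]%SET|)%N.
rewrite (bigID many) /= mulrDl; apply: lerD.
  apply: le_trans (@case_four _ _ x_gt0 x_sq s s0 s1 m G _ _) _.
    move=> w /andP[/andP[/andP[/andP[/OmP[kw _] _] _] /hasN w4] /andP[_ w4d]].
    have [zw kw1 _] := kw; split => // v b wb.
    case: (leqP v b) => h; first by rewrite -wb kunz_below.
    by apply: leq_of_succ; rewrite -wb; apply: kunz_all.
  rewrite exprMM factors4; apply: absorb => //; exact: q0.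
apply: le_trans (@case_three _ _ x_gt0 x_sq s s0 s1 m G _ _) _.
  move=> w /andP[/andP[/andP[/andP[/OmP[kw bw] _] _] /hasN w4] wm].
  have [zw kw1 _] := kw; split => //; last first.
  - by move=> i j b ijb h; apply: leq_trans h (kw1 _ _ _ ijb).
  - case: bw => [[p wp]|[_ wlast]].
      by exists p => u; apply: leq_of_succ; apply: leq_trans wp _; apply: kunz_all.
    exists ord_max => u; rewrite -wlast; apply: kunz_below => //; exact: leq_ord.
  rewrite leqNgt; apply/negP => w4d; move: wm; rewrite /many w4d andbT => /hasN w3.
  move: w4d; rewrite (_ : [set v | _]%SET = finset.set0) ?cards0 //.
  by apply/setP => v; rewrite !inE; apply/negbTE; rewrite neq_ltn ltnS w3.
rewrite exprMM factors6; apply: absorb => //; exact: q0.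
Qed.

End BadSum.

(** * Summability over all lengths *)

Section Transfer.
Variables (R : realType) (x : R).
Hypotheses (x_gt0 : 0 < x) (x_sq : x ^+ 2 = 1 - x).

(** Words of length [m] with letters at most [G + 1], as functions on residues. *)
Definition word_fun m G (w : seq nat) : {ffun 'I_m.+1 -> 'I_G.+2} :=
  [ffun v : 'I_m.+1 => inord (coord w v)].

Lemma word_funE m G w (v : 'I_m.+1) : (word_genus w <= G)%N ->
  word_fun m G w v = coord w v :> nat.
Proof.
move=> wG; rewrite ffunE inordK //.
by apply: leq_trans (leqnSn _); rewrite ltnS; apply: leq_trans (letter_le_genus w v) wG.
Qed.

Lemma weight_word_fun m G w : size w = m -> (word_genus w <= G)%N ->
  weight x (word_fun m G w) = x ^+ word_genus w.
Proof.
move=> wm wG; rewrite /weight.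
under eq_bigr => v _ do rewrite word_funE //.
rewrite -(big_mkord xpredT (fun v => x ^+ coord w v)) -wm.
rewrite -[(size w).+1]/(size (0%N :: w)) -(big_nth 0%N xpredT (fun a => x ^+ a)).
by rewrite big_cons expr0 mul1r expr_sum.
Qed.

Lemma kunz_fun_word_fun m G w : kunz w -> size w = m -> (word_genus w <= G)%N ->
  kunz_fun (word_fun m G w).
Proof.
move=> kw wm wG; split.
- split=> [|v v0]; rewrite word_funE //.
  by apply: kunz_pos => //; rewrite wm leq_ord andbT lt0n.
- move=> i j k ijk; rewrite !word_funE // -ijk; apply: kunz_add => //.
  by rewrite ijk wm leq_ord.
move=> i j k ijk; rewrite !word_funE //.
have -> : nat_of_ord k = (i + j - (size w).+1)%N by rewrite ijk wm addnK.
apply: kunz_wrap; rewrite ?wm ?leq_ord // ijk.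
by apply: leq_trans (leq_addl _ _).
Qed.

Lemma bad_word_fun m G w : kunz w -> size w = m -> (word_genus w <= G)%N ->
  ~ kunz3 w \/ stressed w -> bad_word (word_fun m G w).
Proof.
move=> kw wm wG [n3|sw].
  left; apply: contrapT => h; apply: n3; split => // i iw.
  have im : (i < m.+1)%N by rewrite -wm ltnS; case/andP: iw.
  rewrite letterE; last by case/andP: iw.
  rewrite leqNgt; apply/negP => i4; apply: h; exists (Ordinal im).
  by rewrite word_funE.
have [[_ _] last3] := sw; have [/kunz3P[l3 _] _] := sw.
right; split=> [v|]; rewrite word_funE //; first exact: coord_bound l3.
by rewrite /= -wm stressed_coord.
Qed.

Lemma bad_words_fixed_size : exists2 K : R, 0 <= K & forall m G (s : seq (seq nat)), uniq s ->
  (forall w, w \in s -> [/\ kunz w, size w = m, (word_genus w <= G)%N & ~ kunz3 w \/ stressed w]) ->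
  \sum_(w <- s) x ^+ word_genus w <= K * decay R ^+ m.+1.
Proof.
have [K K0 hK] := bad_words_bound x_gt0 x_sq; exists K => // m G s us sP.
have inj : {in s &, injective (word_fun m G)}.
  move=> w1 w2 /sP[_ m1 G1 _] /sP[_ m2 G2 _] /ffunP e.
  apply: (@eq_from_nth _ 0%N); rewrite m1 ?m2 // => i im.
  have := congr1 (@nat_of_ord _) (e (Ordinal (im : (i.+1 < m.+1)%N))).
  by rewrite !word_funE.
pose Om := [pred f | f \in [seq word_fun m G w | w <- s]].
have -> : \sum_(w <- s) x ^+ word_genus w = \sum_(f | Om f) weight x f.
  rewrite -big_uniq /=; last by rewrite map_inj_in_uniq.
  rewrite big_map big_seq [RHS]big_seq; apply: eq_bigr => w /sP[_ wm wG _].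
  by rewrite weight_word_fun.
apply: hK => f /mapP[w /sP[kw wm wG bw] ->]; split.
  exact: kunz_fun_word_fun.
exact: bad_word_fun.
Qed.

(** Sorting by length instead of genus turns the sum into a geometric series. *)
Lemma bad_words_summable : exists C : R, forall N,
  \sum_(0 <= g < N) (card_set (tall_words g) + card_set (stressed_genus g))%:R * x ^+ g <= C.
Proof.
have [K K0 hK] := bad_words_fixed_size; exists (K * (1 - decay R)^-1) => N.
have [El hEl] := choice (fun g => finite_set_enum (finite_tall_words g)).
have [Es hEs] := choice (fun g => finite_set_enum (finite_stressed_genus g)).
pose E g := El g ++ Es g.
have EP g : [/\ uniq (E g),
   forall w, w \in E g -> [/\ kunz w, word_genus w = g & ~ kunz3 w \/ stressed w] &
   size (E g) = (card_set (tall_words g) + card_set (stressed_genus g))%N].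
  have [ul hl cl] := hEl g; have [us hs cs] := hEs g.
  split; last by rewrite size_cat cl cs.
    rewrite cat_uniq ul us andbT /=; apply/hasPn => w /hs[[k3 _] _]; apply/negP => /hl[_ _].
    by apply.
  move=> w; rewrite mem_cat => /orP[/hl[kw wg k3]|/hs[sw wg]]; first by split => //; left.
  by split => //; [case: sw => -[] | right].
pose s := [seq w | g <- iota 0 N, w <- E g].
have us : uniq s.
  apply: allpairs_uniq_dep => [|g _|]; first exact: iota_uniq.
    by case: (EP g).
  move=> [g w] [g' w'] /allpairsPdep[g1 [w1 [_ h1 [-> ->]]]] /allpairsPdep[g2 [w2 [_ h2 [-> ->]]]] /= e.
  by have [_ /(_ _ h1)[_ <- _] _] := EP g1; have [_ /(_ _ h2)[_ <- _] _] := EP g2; rewrite e.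
have sP w : w \in s -> [/\ kunz w, (word_genus w < N)%N & ~ kunz3 w \/ stressed w].
  move=> /allpairsPdep[g [w1 [gN h ->]]]; have [_ /(_ _ h)[kw wg bw] _] := EP g.
  by split => //; rewrite wg; move: gN; rewrite mem_iota.
have -> : \sum_(0 <= g < N) (card_set (tall_words g) + card_set (stressed_genus g))%:R * x ^+ g =
    \sum_(w <- s) x ^+ word_genus w.
  rewrite big_allpairs_dep /index_iota subn0; apply: eq_bigr => g _.
  have [_ h <-] := EP g; rewrite big_seq.
  under eq_bigr => w /h[_ -> _] do [].
  by rewrite -big_seq big_const_seq count_predT iter_addr_0 mulr_natl.
have -> : \sum_(w <- s) x ^+ word_genus w =
    \sum_(m < N) \sum_(w <- s | size w == m) x ^+ word_genus w.
  rewrite (exchange_big_dep predT) //= big_seq [RHS]big_seq; apply: eq_bigr => w /sP[kw wN _].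
  have wm : (size w < N)%N by apply: leq_ltn_trans wN; apply: size_le_genus (kunz_letters kw).
  by rewrite (big_pred1 (Ordinal wm)).
apply: (@le_trans _ _ (\sum_(m < N) K * decay R ^+ m.+1)).
  apply: ler_sum => m _; rewrite -big_filter; apply: (hK m N); first exact: filter_uniq.
  move=> w; rewrite mem_filter => /andP[/eqP wm /sP[kw wN bw]]; split => //; exact: ltnW.
have d0 := decay_ge0 R; have d1 := decay_lt1 R.
have d1' : 0 < 1 - decay R by rewrite subr_gt0.
rewrite -mulr_sumr ler_wpM2l //.
rewrite -[leRHS]mul1r ler_pdivlMr // mulrC.
under eq_bigr => m _ do rewrite exprS.
rewrite -mulr_sumr mulrCA; apply: (@le_trans _ _ (decay R * 1)); last by rewrite mulr1 ltW.
apply: ler_wpM2l => //.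
have -> : (1 - decay R) * \sum_(m < N) decay R ^+ m = 1 - decay R ^+ N.
  by apply: oppr_inj; rewrite opprB subrX1 -mulNr opprB.
by rewrite gerBl exprn_ge0.
Qed.

End Transfer.

(** * Limits of damped sequences *)

Local Open Scope classical_set_scope.
Local Open Scope ring_scope.

Section Sequences.
Variable R : realType.
Implicit Types (u z e : nat -> R).

Lemma contraction_cvg0 z e (c : R) : 0 <= c -> c < 1 ->
  (forall n, `|z n.+1| <= e n + c * `|z n|) -> e @ \oo --> (0 : R) -> z @ \oo --> (0 : R).
Proof.
move=> c0 c1 step e0; apply/cvgrPdist_lt => eps eps0.
pose d := eps / 2 * (1 - c).
have c1' : 0 < 1 - c by rewrite subr_gt0.
have d0 : 0 < d by rewrite /d mulr_gt0 // divr_gt0.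
have /cvgrPdist_lt /(_ d d0) [N _ hN] := e0.
have eN n : (N <= n)%N -> e n <= d.
  by move=> /hN /=; rewrite sub0r normrN => /ltW; apply: le_trans; apply: ler_norm.
have bound k : `|z (N + k)%N| <= eps / 2 + c ^+ k * `|z N|.
  elim: k => [|k IH]; first by rewrite addn0 expr0 mul1r lerDr divr_ge0 // ltW.
  rewrite addnS; apply: le_trans (step _) _.
  apply: le_trans (lerD (eN _ (leq_addr _ _)) (ler_wpM2l c0 IH)) _.
  by rewrite le_eqVlt; apply/orP; left; apply/eqP; rewrite /d exprS; ring.
have ck : (fun k => c ^+ k * `|z N|) @ \oo --> (0 : R).
  rewrite -[X in _ --> X](mul0r `|z N|); apply: cvgM; last exact: cvg_cst.
  by apply: cvg_expr; rewrite ger0_norm.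
have eps2 : 0 < eps / 2 by rewrite divr_gt0.
have /cvgrPdist_lt /(_ _ eps2) [M _ hM] := ck.
exists (N + M)%N => // n /= NMn; rewrite sub0r normrN.
have -> : n = (N + (n - N))%N by lia.
apply: le_lt_trans (bound _) _; rewrite [ltRHS](splitr eps) ltrD2l.
have /hM /= : (M <= n - N)%N by lia.
by rewrite sub0r normrN; apply: le_lt_trans; apply: ler_norm.
Qed.

(** The deviation of [u] from its limit is contracted by [c] at each step, up to
    an error that tends to 0. *)
Lemma damped_cvg u (v : nat -> R) (c l : R) : 0 <= c -> c < 1 ->
  (forall n, u n.+1 + c * u n = v n) -> v @ \oo --> l -> u @ \oo --> l / (1 + c).
Proof.
move=> c0 c1 uv vl.
have c10 : 1 + c != 0 by rewrite gt_eqF // ltr_wpDr.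
pose a := l / (1 + c); have la : l = a + c * a by rewrite /a; field.
pose z n := u n - a.
have z0 : z @ \oo --> (0 : R).
  apply: (@contraction_cvg0 z (fun n => `|v n - l|) c) => //.
    move=> n; have -> : z n.+1 = (v n - l) - c * z n.
      by rewrite /z -uv [in RHS]la; ring.
    by apply: le_trans (ler_normB _ _) _; rewrite normrM (ger0_norm c0).
  rewrite -(normr0 R); apply: cvg_norm; rewrite -(subrr l).
  by apply: cvgB => //; apply: cvg_cst.
have -> : u = (fun n => z n + a) by apply/funext => n; rewrite /z subrK.
by rewrite -[X in _ --> X]add0r; apply: cvgD z0 _; apply: cvg_cst.
Qed.

Lemma bounded_series_cvg u (C : R) : (forall n, 0 <= u n) ->
  (forall N, \sum_(0 <= n < N) u n <= C) -> cvgn (series u).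
Proof.
move=> u0 uC; apply: nondecreasing_is_cvgn.
  exact: nondecreasing_series.
by exists C => _ [N _ <-]; apply: uC.
Qed.

End Sequences.

Section FibonacciGrowth.
Variables (R : realType) (x : R).
Hypotheses (x_gt0 : 0 < x) (x_sq : x ^+ 2 = 1 - x).

(** The characteristic roots of the Fibonacci recursion are [1 / x] and [- x].
    Dividing out the first root shows that [T(g+1) x ^ (g+1) + x ^ 2 T(g) x ^ g]
    is a partial sum of [1 + l]; the second root leaves a damped recursion. *)
Lemma fibonacci_growth (T S : nat -> R) (l : R) : T 0%N = 1 -> T 1%N = 1 ->
  (forall g, T g.+2 = T g.+1 + T g + S g.+2) ->
  (fun n => \sum_(2 <= h < n) S h * x ^+ h) @ \oo --> l ->
  (fun g => T g * x ^+ g) @ \oo --> (1 + l) / (1 + x ^+ 2).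
Proof.
move=> T0 T1 rec sl.
have x2 : 0 <= x ^+ 2 by rewrite exprn_ge0 // ltW.
have x21 : x ^+ 2 < 1 by rewrite x_sq gtrBl.
apply: (@damped_cvg _ _ (fun n => 1 + \sum_(2 <= h < n.+2) S h * x ^+ h)) => //.
  elim=> [|n IH].
    by rewrite big_geq // addr0 T0 T1 expr0 expr1 mul1r mul1r mulr1 x_sq addrC subrK.
  rewrite big_nat_recr //= addrA -IH rec.
  apply/eqP; rewrite -subr_eq0; apply/eqP.
  transitivity (T n.+1 * x ^+ n * (x ^+ 2 + x ^+ 2 * x - x)); first by rewrite !exprS; ring.
  by rewrite x_sq mulrBl mul1r -expr2 x_sq; ring.
apply: cvgD; first exact: cvg_cst.
have -> : (fun n => \sum_(2 <= h < n.+2) S h * x ^+ h) =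
    (fun n => \sum_(2 <= h < (n + 2)%N) S h * x ^+ h).
  by apply/funext => n; rewrite addn2.
by move: sl; rewrite -(cvg_shiftn 2).
Qed.

End FibonacciGrowth.

(** * Growth of the number of words *)

Section GoldenRatio.
Variable R : realType.
Local Notation phi := (golden R).
Local Notation x := ((golden R)^-1).

Lemma sqrt5_golden : Num.sqrt 5 = 2 * phi - 1 :> R.
Proof. by rewrite /golden; field. Qed.

Lemma golden_gt0 : 0 < phi.
Proof. by rewrite /golden divr_gt0 // ltr_pwDl // sqrtr_ge0. Qed.

Lemma golden_sq : phi ^+ 2 = phi + 1.
Proof.
have h : (Num.sqrt 5 : R) ^+ 2 = 5 by rewrite sqr_sqrtr.
rewrite /golden; move: h; set q := Num.sqrt 5 => h.
have -> : ((1 + q) / 2) ^+ 2 = (1 + 2 * q + q ^+ 2) / 4 by field.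
by rewrite h; field.
Qed.

Lemma golden_inv : x = phi - 1.
Proof.
have p0 := golden_gt0; apply: (@mulfI _ phi); first by rewrite gt_eqF.
by rewrite divff ?gt_eqF // mulrBr mulr1 -expr2 golden_sq addrC addrA addNr add0r.
Qed.

Lemma golden_inv_gt0 : 0 < x.
Proof. by rewrite invr_gt0 golden_gt0. Qed.

Lemma golden_inv_sq : x ^+ 2 = 1 - x.
Proof. by rewrite golden_inv sqrrB1 golden_sq; ring. Qed.

Lemma sqrt5_gt0 : 0 < Num.sqrt 5 :> R.
Proof. by rewrite sqrtr_gt0. Qed.

Lemma golden_over_sqrt5 : phi / Num.sqrt 5 = (1 + x ^+ 2)^-1.
Proof.
have s0 := sqrt5_gt0; have p0 := golden_gt0.
have e : phi * (1 + x ^+ 2) = Num.sqrt 5.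
  by rewrite mulrDr mulr1 expr2 mulrA divff ?gt_eqF // mul1r golden_inv sqrt5_golden; ring.
have c0 : 1 + x ^+ 2 != 0.
  by apply/eqP => h; move: s0; rewrite -e h mulr0 ltxx.
by rewrite -e invfM mulrA divff ?gt_eqF // mul1r.
Qed.

End GoldenRatio.

Section Limits.
Variable R : realType.
Local Notation phi := (golden R).
Local Notation x := ((golden R)^-1).

Lemma stressed_genus_small g : (g < 3)%N -> card_set (stressed_genus g) = 0%N.
Proof.
move=> g3; rewrite (@card_set_seq _ _ [::]) // => w; split => // -[[kw l3] wg].
case/lastP: w kw l3 wg => [//|w a] _; rewrite last_rcons word_genus_rcons => ->; lia.
Qed.

Lemma sum_from (k n : nat) (u : nat -> R) : (forall h, (h < k)%N -> u h = 0) ->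
  \sum_(k <= h < n) u h = \sum_(0 <= h < n) u h.
Proof.
move=> u0; have [kn|nk] := leqP k n.
  rewrite [RHS](big_cat_nat (leq0n k) kn) /= [X in X + _]big1_seq ?add0r // => h.
  by rewrite mem_index_iota => /andP[_ /andP[_ hk]]; apply: u0.
rewrite big_geq; last exact: ltnW.
rewrite big1_seq // => h; rewrite mem_index_iota => /andP[_ /andP[_ hn]].
by apply: u0; apply: ltn_trans nk.
Qed.

Definition stressed_term (h : nat) : R := (card_set (stressed_genus h))%:R * x ^+ h.

Lemma x_exp_ge0 n : 0 <= x ^+ n.
Proof. by rewrite exprn_ge0 // ltW // golden_inv_gt0. Qed.

Lemma stressed_series_cvg : cvgn (series stressed_term).
Proof.
have [C hC] := bad_words_summable (golden_inv_gt0 R) (golden_inv_sq R).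
apply: (@bounded_series_cvg _ _ C) => [n|N]; first by rewrite mulr_ge0 // x_exp_ge0.
apply: le_trans (hC N); apply: ler_sum => g _.
by rewrite ler_wpM2r ?x_exp_ge0 // ler_nat leq_addl.
Qed.

Lemma tall_term_cvg0 : (fun g => (card_set (tall_words g))%:R * x ^+ g) @ \oo --> (0 : R).
Proof.
have [C hC] := bad_words_summable (golden_inv_gt0 R) (golden_inv_sq R).
apply: cvg_series_cvg_0.
apply: (@bounded_series_cvg _ _ C) => [n|N]; first by rewrite mulr_ge0 // x_exp_ge0.
apply: le_trans (hC N); apply: ler_sum => g _.
by rewrite ler_wpM2r ?x_exp_ge0 // ler_nat leq_addr.
Qed.

Lemma stressed_small h : (h < 3)%N -> stressed_term h = 0.
Proof. by move=> h3; rewrite /stressed_term stressed_genus_small // mul0r. Qed.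

(** This is where [golden / sqrt 5 = 1 / (1 + x ^ 2)] enters. *)
Lemma growth_constantE : growth_constant R = (1 + limn (series stressed_term)) / (1 + x ^+ 2).
Proof.
rewrite /growth_constant golden_over_sqrt5 mulrC.
suff -> : (fun n => \sum_(3 <= g < n) (s_ g)%:~R * phi ^- g) = series stressed_term by [].
apply/funext => n; rewrite /series /= -(@sum_from 3) //; last exact: stressed_small.
rewrite big_nat_cond [RHS]big_nat_cond; apply: eq_bigr => -[|[|g]] // _.
by rewrite s_card /stressed_term exprVn.
Qed.

Lemma growth_constant_gt0 : 0 < growth_constant R.
Proof.
rewrite growth_constantE; apply: divr_gt0; last by rewrite ltr_pwDl // x_exp_ge0.
rewrite ltr_pwDl //; apply: limr_ge; first exact: stressed_series_cvg.
by near=> n; apply: sumr_ge0 => h _; rewrite mulr_ge0 // x_exp_ge0.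
Unshelve. all: by end_near. Qed.

Lemma card_genus0 (A : set (seq nat)) : A `<=` kunz_words 0 -> A [::] -> card_set A = 1%N.
Proof.
move=> A0 An; rewrite (@card_set_seq _ _ [:: [::]]) // => w; rewrite inE; split=> [|/eqP -> //].
by move=> /A0[kw w0]; rewrite (word_genus0 (kunz_letters kw) w0).
Qed.

Lemma card_genus1 (A : set (seq nat)) : A `<=` kunz_words 1 -> A [:: 1%N] -> card_set A = 1%N.
Proof.
move=> A1 An; rewrite (@card_set_seq _ _ [:: [:: 1%N]]) // => w; rewrite inE; split=> [|/eqP -> //].
move=> /A1[/kunz_letters kw w1]; case: w kw w1 => [|a w]; first by rewrite /word_genus big_nil.
rewrite word_genus_cons /letters_in /= => /andP[/andP[a1 _] lw] w1.
have /size0nil w0 : size w = 0%N.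
  apply/eqP; rewrite -leqn0 -(leq_add2l a) addn0; apply: leq_trans a1.
  by rewrite -[leqRHS]w1 leq_add2l (size_le_genus lw).
by move: w1; rewrite w0 /word_genus big_nil addn0 => ->.
Qed.

Lemma flat_words_sub g : flat_words g `<=` kunz_words g.
Proof. by move=> w [lw wg]; split => //; case: (kunz3_flat lw). Qed.

Lemma kunz3_words_sub g : kunz3_words g `<=` kunz_words g.
Proof. by move=> w [[kw _] wg]. Qed.

Lemma flat_growth : (fun g => (card_set (flat_words g))%:R * x ^+ g) @ \oo --> (1 + x ^+ 2)^-1.
Proof.
rewrite -[X in _ --> X]mul1r -{2}[1](addr0 1).
apply: (@fibonacci_growth _ _ (golden_inv_gt0 R) (golden_inv_sq R) _ (fun=> 0)).
- rewrite card_genus0 //; first exact: flat_words_sub.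
  by split; rewrite ?/word_genus ?big_nil.
- rewrite card_genus1 //; first exact: flat_words_sub.
  by split; rewrite ?word_genus1.
- by move=> g; rewrite card_flat_rec natrD addr0.
under eq_fun => n do (under eq_bigr do rewrite mul0r; rewrite big1_eq).
exact: cvg_cst.
Qed.

Lemma kunz3_growth :
  (fun g => (card_set (kunz3_words g))%:R * x ^+ g) @ \oo --> growth_constant R.
Proof.
rewrite growth_constantE.
apply: (@fibonacci_growth _ _ (golden_inv_gt0 R) (golden_inv_sq R) _
  (fun h => (card_set (stressed_genus h))%:R)).
- rewrite card_genus0 //; first exact: kunz3_words_sub.
  by split; rewrite ?/word_genus ?big_nil //; apply: kunz3_nil.
- rewrite card_genus1 //; first exact: kunz3_words_sub.
  by split; rewrite ?word_genus1 //; apply: kunz3_flat.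
- by move=> g; rewrite card_kunz3_rec !natrD.
have -> : (fun n => \sum_(2 <= h < n) (card_set (stressed_genus h))%:R * x ^+ h) = series stressed_term.
  apply/funext => n; rewrite /series /= -(@sum_from 2) // => h h2.
  by apply: stressed_small; apply: ltnW.
exact: stressed_series_cvg.
Qed.

Lemma kunz_growth :
  (fun g => (card_set (kunz_words g))%:R * x ^+ g) @ \oo --> growth_constant R.
Proof.
have -> : (fun g => (card_set (kunz_words g))%:R * x ^+ g) =
    (fun g => (card_set (kunz3_words g))%:R * x ^+ g + (card_set (tall_words g))%:R * x ^+ g).
  by apply/funext => g; rewrite card_kunz_words natrD mulrDl.
rewrite -[growth_constant R]addr0; apply: cvgD; [exact: kunz3_growth | exact: tall_term_cvg0].
Qed.

(** The words of depth at least 4 are negligible in the numerator as well as in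
    the denominator, so only 3-Kunz words have to be counted. *)
Lemma probability_cvg (k : int) (A : R) :
  (fun g => (card_set [set w | kunz3_words g w /\ offset w = k])%:R * x ^+ g) @ \oo --> A ->
  (fun g : nat =>
     uniform_prob_on R (semigroups g)
       [set L | frobenius L - 2 * (multiplicity L)%:Z = k]) @ \oo --> A / growth_constant R.
Proof.
move=> cA.
have x0 := golden_inv_gt0 R.
have total g : card_set (semigroups g) = card_set (kunz_words g).
  rewrite -[semigroups g]setIT semigroups_card; congr card_set.
  by apply/seteqP; split => w //= [].
pose ct g := card_set [set w | tall_words g w /\ offset w = k].
have event g : card_set (semigroups g `&` [set L | frobenius L - 2 * (multiplicity L)%:Z = k]) =
    (card_set [set w | kunz3_words g w /\ offset w = k] + ct g)%N.
  rewrite semigroups_card -card_setU; first last.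
  - by move=> w [[k3 _] _] [[_ _ n3] _].
  - by apply: sub_finite_set (finite_tall_words g) => w [].
  - by apply: sub_finite_set (finite_kunz3_words g) => w [].
  congr card_set; apply/seteqP; split=> [w [[kw wg] ow]|w [[[[kw _] wg] ow]|[[kw wg _] ow]]] //.
  by case: (pselect (kunz3 w)) => k3; [left | right].
have ct0 : (fun g => (ct g)%:R * x ^+ g) @ \oo --> (0 : R).
  apply: (@squeeze_cvgr _ _ _ _ (fun=> 0) (fun g => (card_set (tall_words g))%:R * x ^+ g)).
  - near=> g; rewrite mulr_ge0 ?x_exp_ge0 //= ler_wpM2r ?x_exp_ge0 // ler_nat.
    by apply: card_set_le; [exact: finite_tall_words | move=> w []].
  - exact: cvg_cst.
  - exact: tall_term_cvg0.
have -> : (fun g : nat => uniform_prob_on R (semigroups g)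
       [set L | frobenius L - 2 * (multiplicity L)%:Z = k]) =
   (fun g => ((card_set [set w | kunz3_words g w /\ offset w = k])%:R * x ^+ g + (ct g)%:R * x ^+ g)
      / ((card_set (kunz_words g))%:R * x ^+ g)).
  apply/funext => g; rewrite /uniform_prob_on event total natrD -mulrDl.
  by rewrite -mulf_div divff ?mulr1 // expf_neq0 // gt_eqF.
apply: cvgM; first by rewrite -[A]addr0; apply: cvgD.
apply: cvgV; last exact: kunz_growth.
by rewrite gt_eqF // growth_constant_gt0.
Unshelve. all: by end_near. Qed.

Lemma flat_shift (h : nat) :
  (fun g => (card_set (flat_words (g - h)))%:R * x ^+ g) @ \oo --> x ^+ h / (1 + x ^+ 2).
Proof.
rewrite -(cvg_shiftn h) /=.
have -> : (fun n => (card_set (flat_words (n + h - h)))%:R * x ^+ (n + h)) =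
    (fun n => x ^+ h * ((card_set (flat_words n))%:R * x ^+ n)).
  by apply/funext => n; rewrite addnK exprD mulrA mulrC.
by apply: cvgM; [exact: cvg_cst | exact: flat_growth].
Qed.

End Limits.

(** * The limit distribution *)

Lemma offset_limit_pos (R : realType) (k : nat) : (0 < k)%N ->
  (fun g => (card_set [set w | kunz3_words g w /\ offset w = k%:Z])%:R * (golden R)^-1 ^+ g) @ \oo -->
  (\sum_(w \in stressed_words k) (golden R)^-1 ^+ word_genus w) / (1 + (golden R)^-1 ^+ 2).
Proof.
move=> k0; have [s [us sE _]] := finite_set_enum (finite_stressed_words k).
pose h := (\max_(u <- s) word_genus u)%N.
have sh u : u \in s -> (word_genus u <= h)%N by move=> us'; apply: leq_bigmax_seq.
have -> : stressed_words k = [set` s].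
  by apply/seteqP; split => w /= => [/sE|ws] //; apply/sE.
rewrite -fsbig_seq //= mulr_suml.
have cvg_s : (fun g => \sum_(u <- s) (card_set (flat_words (g - word_genus u)))%:R * (golden R)^-1 ^+ g)
    @ \oo --> \sum_(u <- s) (golden R)^-1 ^+ word_genus u / (1 + (golden R)^-1 ^+ 2).
  have add_cont : continuous (fun p : R * R => p.1 + p.2) by exact: add_continuous.
  by apply: (cvg_big add_cont) => u _; apply: flat_shift.
apply: cvg_trans cvg_s; apply: near_eq_cvg; exists h => // g /= hg.
rewrite (@count_offset_pos k s) // => [|u us']; last exact: leq_trans (sh u us') hg.
by rewrite natr_sum mulr_suml.
Qed.

Lemma offset_limit_neg (R : realType) (j : nat) :
  (fun g => (card_set [set w | kunz3_words g w /\ offset w = - j.+1%:Z])%:R * (golden R)^-1 ^+ g)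
    @ \oo --> (golden R)^-1 ^+ j.+2 / (1 + (golden R)^-1 ^+ 2).
Proof.
apply: cvg_trans (@flat_shift R j.+2); apply: near_eq_cvg; exists j.+3 => // g /= hg.
by rewrite count_offset_neg ?addn2.
Qed.

Theorem theorem6p2 (R : realType) (k : int) :
  (fun g : nat =>
     uniform_prob_on R (semigroups g)
       [set L | frobenius L - 2 * (multiplicity L)%:Z = k]) @ \oo
  --> (if k < 0 then
         1 / (Num.sqrt 5 * growth_constant R) * golden R ^ k
       else if k == 0 then 0
       else
         1 / (Num.sqrt 5 * growth_constant R) *
           \sum_(w \in stressed_words `|k|%N)
             golden R ^ (1 - (word_genus w)%:Z)).
Proof.
have p0 := golden_gt0 R; have pn0 : golden R != 0 by rewrite gt_eqF.
case: k => [[|k]|j].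
- rewrite ltxx eqxx -[X in _ --> X](mul0r (growth_constant R)^-1).
  apply: probability_cvg; under eq_fun => g do rewrite count_offset_zero mul0r.
  exact: cvg_cst.
- have -> : (k.+1%:Z < 0) = false by [].
  have -> : (k.+1%:Z == 0) = false by [].
  set A := (X in _ --> X).
  suff -> : A = (\sum_(w \in stressed_words k.+1) (golden R)^-1 ^+ word_genus w) /
      (1 + (golden R)^-1 ^+ 2) / growth_constant R.
    by apply: probability_cvg; apply: offset_limit_pos.
  have [s [us sE _]] := finite_set_enum (finite_stressed_words k.+1).
  have sS : stressed_words k.+1 = [set` s].
    by apply/seteqP; split => w /= => [/sE|ws] //; apply/sE.
  rewrite /A /= sS -!fsbig_seq //= -golden_over_sqrt5.
  have term w : golden R ^ (1 - (word_genus w)%:Z) = golden R * (golden R)^-1 ^+ word_genus w.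
    by rewrite expfzDr // expr1z -exprnN exprVn.
  under eq_bigr => w _ do rewrite term.
  by rewrite -mulr_sumr mul1r invfM; ring.
rewrite NegzE.
have -> : - j.+1%:Z < 0 by [].
set A := (X in _ --> X).
suff -> : A = (golden R)^-1 ^+ j.+2 / (1 + (golden R)^-1 ^+ 2) / growth_constant R.
  by apply: probability_cvg; apply: offset_limit_neg.
rewrite /A -golden_over_sqrt5 -exprnN -exprVn mul1r invfM (exprS _ j.+1).
have -> : (golden R)^-1 * (golden R)^-1 ^+ j.+1 * (golden R / Num.sqrt 5) =
   ((golden R)^-1 * golden R) * (golden R)^-1 ^+ j.+1 / Num.sqrt 5 by ring.
by rewrite mulVf // mul1r mulrC mulrA.
Qed.
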